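(* Let $l$ be a positive integer. For each partition $\lambda$ of $l$ let $\Lambda^\circ$ be the column tableau of shape $\lambda$ and let $V_\lambda=H_lF_{\Lambda^\circ}$ be the left ideal of $H_l$ generated by $F_{\Lambda^\circ}$, regarded as an $H_l$-module via left multiplication. Then the $H_l$-modules $V_\lambda$ for different partitions $\lambda$ of $l$ are pairwise non-equivalent.
   Context: Let $q$ be a formal parameter. $H_l$ is the $\mathbb{C}(q)$-algebra with generators $T_1,\ldots,T_{l-1}$ and relations $(T_i-q)(T_i+q^{-1})=0$; $T_iT_{i+1}T_i=T_{i+1}T_iT_{i+1}$; $T_iT_j=T_jT_i$ for $|i-j|\ge2$. The Young diagram of $\lambda$ is $\{(a,b)\in\mathbb{Z}^2: 1\le a,\ 1\le b\le\lambda_a\}$. A tableau of shape $\lambda$ is a bijection $\Lambda$ from the diagram to $\{1,\ldots,l\}$; it is standard if $\Lambda(a,b)<\Lambda(a+1,b)$ and $\Lambda(a,b)<\Lambda(a,b+1)$ whenever defined. If $\Lambda(a,b)=i$ put $c_i(\Lambda)=b-a$. The column tableau $\Lambda^\circ$ of shape $\lambda$ is the standard tableau with $\Lambda^\circ(a+1,b)=\Lambda^\circ(a,b)+1$ (filled by $1,\ldots,l$ down successive columns from left to right). Put $F_i(x,y)=T_i+\dfrac{q-q^{-1}}{x^{-1}y-1}$. For a standard tableau $\Lambda$ let $F_\Lambda(z_1,\ldots,z_l)=\prod^{\longrightarrow}_{(i,j)}F_{j-i}(q^{2c_i(\Lambda)}z_i,q^{2c_j(\Lambda)}z_j)$, the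 product over pairs $1\le i<j\le l$ ordered from left to right so that $(i,j)$ precedes $(i',j')$ if $j<j'$, or $j=j'$ and $i<i'$. Let $\mathcal{Z}_\Lambda\subset\mathbb{C}(q)^{\times l}$ be the subspace of tuples with $z_i=z_j$ whenever $i,j$ are in the same column of $\Lambda$. The restriction of $F_\Lambda(z_1,\ldots,z_l)$ to $\mathcal{Z}_\Lambda$ is regular at $(1,\ldots,1)$; its value there is $F_\Lambda\in H_l$. *)

(* Defs.v *)
From HB Require Import structures.
From mathcomp Require Import all_boot all_order all_algebra.
From mathcomp Require Import boolp classical_sets reals.
From mathcomp Require Import complex.
From mathcomp Require Import finmap.
From mathcomp Require Import monalg.

Set Implicit Arguments.
Unset Strict Implicit.
Unset Printing Implicit Defensive.

Import GRing.Theory.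
Local Open Scope ring_scope.
Local Open Scope quotient_scope.

Inductive two_sided_ideal (A : nzRingType) (S : A -> Prop) : A -> Prop :=
  | tsi_gen x : S x -> two_sided_ideal S x
  | tsi_zero : two_sided_ideal S 0
  | tsi_add x y :
      two_sided_ideal S x -> two_sided_ideal S y -> two_sided_ideal S (x + y)
  | tsi_mull a x : two_sided_ideal S x -> two_sided_ideal S (a * x)
  | tsi_mulr x a : two_sided_ideal S x -> two_sided_ideal S (x * a).

Fact subr_mulmul (A : nzRingType) (x y x' y' : A) :
  x' * y' - x * y = (x' - x) * y' + x * (y' - y).
Proof. by rewrite mulrBl mulrBr subrKA. Qed.

Fact rmorph_braid (A B : nzRingType) (f : {rmorphism A -> B}) (x y : A) :
  f x = f y -> f (x * y * x - y * x * y) = 0.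
Proof. by move=> e; rewrite rmorphB !rmorphM e subrr. Qed.

Fact rmorph_commutator (A B : nzRingType) (f : {rmorphism A -> B}) (x y : A) :
  f x = f y -> f (x * y - y * x) = 0.
Proof. by move=> e; rewrite rmorphB !rmorphM e subrr. Qed.

Section HeckeAlgebra.
Variables (K : fieldType) (q : K) (l : nat).

(* H_l is the quotient of the free algebra on T_1, ..., T_(l-1) by the        *)
(* two-sided ideal generated by the relations; i : 'I_l.-1 indexes T_(i+1).   *)
Local Notation free_alg := {malg K[{fmonom 'I_l.-1}]}.

Definition free_gen (i : 'I_l.-1) : free_alg := << fmu i >>.

Inductive hecke_rel : free_alg -> Prop :=
  | hecke_quadratic (i : 'I_l.-1) :
      hecke_rel ((free_gen i - q%:A) * (free_gen i + q^-1%:A))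
  | hecke_braid (i j : 'I_l.-1) of (j = i.+1 :> nat) :
      hecke_rel (free_gen i * free_gen j * free_gen i
                 - free_gen j * free_gen i * free_gen j)
  | hecke_far (i j : 'I_l.-1) of (i.+2 <= j)%N || (j.+2 <= i)%N :
      hecke_rel (free_gen i * free_gen j - free_gen j * free_gen i).

Definition hecke_ideal : {pred free_alg} :=
  fun x => `[< two_sided_ideal hecke_rel x >].

Fact hecke_ideal_zmod_closed : zmod_closed hecke_ideal.
Proof.
split=> [|x y /asboolP hx /asboolP hy]; apply/asboolP; first exact: tsi_zero.
by apply: tsi_add => //; rewrite -mulN1r; apply: tsi_mull.
Qed.
HB.instance Definition _ :=
  GRing.isZmodClosed.Build _ hecke_ideal hecke_ideal_zmod_closed.

Lemma hecke_idealMl a x : x \in hecke_ideal -> a * x \in hecke_ideal.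
Proof. by move=> /asboolP hx; apply/asboolP; apply: tsi_mull. Qed.

Lemma hecke_idealMr x a : x \in hecke_ideal -> x * a \in hecke_ideal.
Proof. by move=> /asboolP hx; apply/asboolP; apply: tsi_mulr. Qed.

(* The ideal is proper: T_i |-> q extends to a character of the free algebra  *)
(* that kills the relations.                                                  *)
Let wt (m : {fmonom 'I_l.-1}) : K := q ^+ fdeg m.

Fact wt_mmorphism : mmorphism wt.
Proof. by split=> [x y|]; rewrite /wt ?fdegM ?exprD ?fdeg1. Qed.
HB.instance Definition _ := isMultiplicative.Build _ _ wt wt_mmorphism.

Let character : free_alg -> K := mmap idfun wt.

Fact character_gen i : character (free_gen i) = q.
Proof. by rewrite /character mmapU /= mul1r /wt fdegU expr1. Qed.

Fact character_scal c : character c%:A = c.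
Proof.
by rewrite /character (mmapZ (f := idfun)) /= (mmap1 (f := idfun)) mulr1.
Qed.

Fact hecke_ideal1 : 1 \notin hecke_ideal.
Proof.
have chM : {morph character : x y / x * y}.
  by move=> x y; rewrite /character rmorphM.
have chB : {morph character : x y / x - y}.
  by move=> x y; rewrite /character rmorphB.
have chD : {morph character : x y / x + y}.
  by move=> x y; rewrite /character rmorphD.
suff h x : two_sided_ideal hecke_rel x -> character x = 0.
  apply/negP => /asboolP/h/eqP; rewrite /character rmorph1.
  by rewrite oner_eq0.
elim=> {x} [x [i|i j _|i j _]||x y _ hx _ hy|a x _ hx|x a _ hx].
- by rewrite chM chB character_gen character_scal subrr mul0r.
- apply: rmorph_braid.
  exact: etrans (character_gen i) (esym (character_gen j)).
- apply: rmorph_commutator.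
  exact: etrans (character_gen i) (esym (character_gen j)).
- by rewrite /character rmorph0.
- by rewrite chD hx hy addr0.
- by rewrite chM hx mulr0.
- by rewrite chM hx mul0r.
Qed.

Definition hecke := Quotient.quot hecke_ideal.
HB.instance Definition _ :=
  EqQuotient.copy hecke (Quotient.quot hecke_ideal).
HB.instance Definition _ := GRing.Zmodule.on hecke.

Fact hecke_piD : {morph \pi_hecke : x y / x + y}.
Proof. by move=> x y; rewrite !piE. Qed.

Fact hecke_pi_eq x y : (\pi_hecke x == \pi_hecke y) = (x - y \in hecke_ideal).
Proof. by rewrite -Quotient.idealrBE. Qed.

Definition hecke_one : hecke := \pi_hecke 1.
Definition hecke_mul := lift_op2 hecke (fun x y : free_alg => x * y).
Definition hecke_scale (c : K) := lift_op1 hecke (fun x : free_alg => c *: x).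

Fact hecke_repr x : repr (\pi_hecke x) - x \in hecke_ideal.
Proof. by rewrite -hecke_pi_eq reprK. Qed.

Fact hecke_piM x y : hecke_mul (\pi_hecke x) (\pi_hecke y) = \pi_hecke (x * y).
Proof.
unlock hecke_mul; apply/eqP; rewrite hecke_pi_eq.
rewrite (subr_mulmul x y (repr (\pi_hecke x)) (repr (\pi_hecke y))).
by apply: rpredD; [apply: hecke_idealMr | apply: hecke_idealMl];
  exact: hecke_repr.
Qed.

Fact hecke_piZ c x : hecke_scale c (\pi_hecke x) = \pi_hecke (c *: x).
Proof.
unlock hecke_scale; apply/eqP; rewrite hecke_pi_eq.
rewrite -scalerBr -[X in c *: X]mul1r scalerAl.
by rewrite hecke_idealMl // hecke_repr.
Qed.

Fact hecke_mulA : associative hecke_mul.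
Proof.
by move=> x y z; rewrite -[x]reprK -[y]reprK -[z]reprK !hecke_piM mulrA.
Qed.

Fact hecke_mul1 : left_id hecke_one hecke_mul.
Proof. by move=> x; rewrite -[x]reprK hecke_piM mul1r. Qed.

Fact hecke_mulr1 : right_id hecke_one hecke_mul.
Proof. by move=> x; rewrite -[x]reprK hecke_piM mulr1. Qed.

Fact hecke_mulDl : left_distributive hecke_mul +%R.
Proof.
move=> x y z; rewrite -[x]reprK -[y]reprK -[z]reprK.
by rewrite -hecke_piD !hecke_piM mulrDl hecke_piD.
Qed.

Fact hecke_mulDr : right_distributive hecke_mul +%R.
Proof.
move=> x y z; rewrite -[x]reprK -[y]reprK -[z]reprK.
by rewrite -hecke_piD !hecke_piM mulrDr hecke_piD.
Qed.

Fact hecke_one_neq0 : hecke_one != 0.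
Proof.
have -> : 0 = \pi_hecke 0 by rewrite !piE.
by rewrite hecke_pi_eq subr0 hecke_ideal1.
Qed.

HB.instance Definition _ := GRing.Zmodule_isNzRing.Build hecke
  hecke_mulA hecke_mul1 hecke_mulr1 hecke_mulDl hecke_mulDr hecke_one_neq0.

Fact hecke_scaleA a b x :
  hecke_scale a (hecke_scale b x) = hecke_scale (a * b) x.
Proof. by rewrite -[x]reprK !hecke_piZ scalerA. Qed.

Fact hecke_scale1 : left_id 1 hecke_scale.
Proof. by move=> x; rewrite -[x]reprK hecke_piZ scale1r. Qed.

Fact hecke_scaleDr : right_distributive hecke_scale +%R.
Proof.
move=> c x y; rewrite -[x]reprK -[y]reprK.
by rewrite -hecke_piD !hecke_piZ scalerDr hecke_piD.
Qed.

Fact hecke_scaleDl x : {morph hecke_scale^~ x : a b / a + b}.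
Proof.
by move=> a b; rewrite -[x]reprK !hecke_piZ scalerDl hecke_piD.
Qed.

HB.instance Definition _ := GRing.Zmodule_isLmodule.Build K hecke
  hecke_scaleA hecke_scale1 hecke_scaleDr hecke_scaleDl.

Fact hecke_scaleAl c (x y : hecke) : c *: (x * y) = (c *: x) * y.
Proof.
rewrite -[x]reprK -[y]reprK.
rewrite /GRing.scale /GRing.mul /=.
by rewrite !(hecke_piM, hecke_piZ) scalerAl.
Qed.

HB.instance Definition _ :=
  GRing.Lmodule_isLalgebra.Build K hecke hecke_scaleAl.

Fact free_scaleAr c (x y : free_alg) : c *: (x * y) = x * (c *: y).
Proof.
apply/malgP => k; rewrite (mcoeffZ c (x * y) k) (mcoeffMl x y k).
rewrite (mcoeffMlw k (fsubset_refl (msupp x)) (msuppZ_le c y)).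
rewrite big_distrr /=; apply: eq_bigr => k1 _.
rewrite big_distrr /=; apply: eq_bigr => k2 _.
by rewrite mcoeffZ [in RHS]mulrCA mulrnAr.
Qed.

Fact hecke_scaleAr c (x y : hecke) : c *: (x * y) = x * (c *: y).
Proof.
rewrite -[x]reprK -[y]reprK.
rewrite /GRing.scale /GRing.mul /=.
by rewrite !(hecke_piM, hecke_piZ) free_scaleAr.
Qed.

HB.instance Definition _ :=
  GRing.Lalgebra_isAlgebra.Build K hecke hecke_scaleAr.

(* T_k, meaningful only for 1 <= k < l. *)
Definition hecke_T (k : nat) : hecke :=
  if insub k.-1 is Some i then \pi_hecke (free_gen i) else 0.
End HeckeAlgebra.

(* Multivariate polynomials are written mpoly n K below: the braced notation  *)
(* is taken by monalg, where it means something else.                         *)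
From mathcomp Require Import mpoly.

Definition is_partition_of (l : nat) (la : seq nat) : bool :=
  [&& sorted geq la, 0%N \notin la & sumn la == l].

(* Boxes (a, b) of the Young diagram, with a and b both counted from 0. *)
Definition box (la : seq nat) : finType :=
  {a : 'I_(size la) & 'I_(nth 0%N la a)}.

Definition row_of (la : seq nat) (x : box la) : nat := tag x.
Definition col_of (la : seq nat) (x : box la) : nat := tagged x.

(* Entries are counted from 0 as well: the value i : 'I_l stands for i + 1. *)
Record tableau (l : nat) (la : seq nat) := Tableau {
  entry :> box la -> 'I_l;
  entry_bij : bijective entry
}.

Definition standard (l : nat) (la : seq nat) (L : tableau l la) : Prop :=
  forall x y : box la,
    (row_of y = (row_of x).+1 /\ col_of y = col_of x) \/
    (row_of y = row_of x /\ col_of y = (col_of x).+1) ->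
  (L x < L y)%N.

Definition column_tableau (l : nat) (la : seq nat) (L : tableau l la) : Prop :=
  standard L /\
  forall x y : box la,
    row_of y = (row_of x).+1 -> col_of y = col_of x -> L y = (L x).+1 :> nat.

Definition content (l : nat) (la : seq nat) (L : tableau l la) (i : 'I_l) :
    int :=
  if [pick x | L x == i] is Some x then (col_of x)%:Z - (row_of x)%:Z else 0.

(* f gives the values on D of a rational H-valued function on the linear      *)
(* subspace Z; this says that the function is regular at a with value v,      *)
(* i.e. that it equals P / d near a for a polynomial d with d(a) nonzero and  *)
(* an H-valued polynomial P, presented as a finite sum of terms p_k(z) h_k.   *)
Definition regular_value (K : fieldType) (H : lmodType K) (n : nat)
    (Z D : set ('I_n -> K)) (f : ('I_n -> K) -> H) (a : 'I_n -> K) (v : H) :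
    Prop :=
  exists (d : mpoly n K) (P : seq (mpoly n K * H)),
    [/\ d.@[a] != 0,
        forall z, Z z -> D z ->
          d.@[z] *: f z = \sum_(ph <- P) ph.1.@[z] *: ph.2 &
        v = d.@[a]^-1 *: \sum_(ph <- P) ph.1.@[a] *: ph.2].

Section FLambda.
Variables (K : fieldType) (q : K) (l : nat).

Definition F_factor (i : nat) (x y : K) : hecke q l :=
  hecke_T q l i + ((q - q^-1) / (x^-1 * y - 1))%:A.

Variables (la : seq nat) (L : tableau l la).

Definition F_arg (z : 'I_l -> K) (i : 'I_l) : K := q ^ (2 * content L i) * z i.

(* In a noncommutative ring \prod multiplies from left to right, so (i, j)    *)
(* precedes (i', j') iff j < j', or j = j' and i < i'.                        *)
Definition F_fun (z : 'I_l -> K) : hecke q l :=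
  \prod_(j < l) \prod_(i < l | (i < j)%N)
    F_factor (j - i) (F_arg z i) (F_arg z j).

Definition F_dom : set ('I_l -> K) :=
  [set z | forall i j : 'I_l, (i < j)%N ->
    F_arg z i != 0 /\ (F_arg z i)^-1 * F_arg z j - 1 != 0].

Definition Z_space : set ('I_l -> K) :=
  [set z | forall x y : box la, col_of x = col_of y -> z (L x) = z (L y)].

Definition F_val : hecke q l :=
  xget 0 [set v | regular_value Z_space F_dom F_fun (fun=> 1) v].
End FLambda.

Section LeftIdeal.
Variables (A : nzRingType) (a : A).

Definition left_ideal : {pred A^o} := fun x => `[< exists h : A, x = h * a >].

Fact left_ideal_submod_closed : submod_closed left_ideal.
Proof.
split=> [|c x y /asboolP[h ->] /asboolP[k ->]]; apply/asboolP.
  by exists 0; rewrite mul0r.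
by exists (c * h + k); rewrite mulrDl -mulrA.
Qed.
HB.instance Definition _ :=
  GRing.isSubmodClosed.Build A A^o left_ideal left_ideal_submod_closed.

Record left_ideal_mod := LeftIdealMod {
  left_ideal_val :> A^o;
  left_ideal_valP : left_ideal_val \in left_ideal
}.
HB.instance Definition _ := [isSub for left_ideal_val].
HB.instance Definition _ := [Choice of left_ideal_mod by <:].
HB.instance Definition _ := [SubChoice_isSubLmodule of left_ideal_mod by <:].
End LeftIdeal.

Section Vmodule.
Variable R : realType.

Definition Cq : fieldType := {fraction {poly R[i]}}.
Definition qC : Cq := tofrac 'X.

Definition V (l : nat) (la : seq nat) (L : tableau l la) :
    lmodType (hecke qC l) :=
  left_ideal_mod (F_val qC L).
End Vmodule.

Definition equivalent_modules (A : nzRingType) (M N : lmodType A) : Prop :=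
  exists f : {linear M -> N}, bijective f.

(* Main.v *)
Require Import Defs.
From mathcomp Require Import all_boot all_order all_algebra.
From mathcomp Require Import reals.
From mathcomp Require Import boolp classical_sets complex finmap monalg.
From mathcomp Require Import ring zify.

(**
The Jucys-Murphy elements J_1 = 1, J_(k+1) = T_k J_k T_k of the Hecke algebra
have a central sum Z.  If F is the fusion element of the column tableau of a
partition, then J_k F = q^(2 c_k) F, where c_k is the content of the entry k,
so Z acts on the left ideal H F by the scalar chi, the sum of q^(2 c) over the
boxes of the diagram.  An isomorphism between two such modules forces the two
scalars to agree, because F is not zero ([left_ideal_scalar]).  The scalar
determines the partition: a column of height m in position b contributes to
(q^2 - 1) chi the two terms q^2 q^(2b) - q^2 q^(2(b - m)), the numbers b - m
increase strictly with b, and q is transcendental ([contents_sum_heights]).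

It remains to make sense of F, to find the eigenvalues and to see that F does
not vanish.

Fusion.  A new box with value u multiplies the product by one factor
F(x, u) for each earlier box, with a pole wherever u equals the value x of an
earlier box.  The product built so far is annihilated from the right by
T_j + q^-1 for the pairs of neighbours in a column.  Modulo this, the factors of
a column of height m with last value y collapse to D + f Q, where
D = T_(p+m-1) ... T_p, the element Q does not depend on u, and the coefficient f
has a pole at u = y alone ([desc_prod_block]).  The last box of an earlier
column never has the content of a new box, so the product of the collapsed
blocks, [fused], is defined at every point of interest: it equals the rational
function F_Lambda(z) at generic z, and its value at z = (1, ..., 1) is F_Lambda
([F_val_fusion]).

Eigenvalues.  Let E be the product for the first k boxes, with values
x_1, ..., x_k.  By induction on the number of boxes,
  E (u - J_(k+1)) = (u - 1) E T_k ... T_1 F_1(u, x_k) ... F_k(u, x_1)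
for generic u.  Multiplying by the factors of a new box of value u, unitarity
turns the right side into a scalar multiple of E T_k ... T_1, and this scalar
telescopes along the columns to a function that vanishes when u is the value of
the next box ([prod_unitary_staircase]); hence the new eigenvalue
([jm_eigen_new_box]).  The Yang-Baxter relation then carries the displayed
identity to k + 1 boxes ([resolvent_exchange], [resolvent_absorb]).  After
clearing denominators every step is a polynomial identity in one scalar, and can
be checked at generic scalars only ([polynomial_in_cofinite_eq]).

Non-vanishing.  The algebra acts on functions of injective words by a
q-deformation of the permutation of positions.  Among all terms of the product
only the one with the maximal number of factors T_i moves the letters far enough
to reverse the word, and its coefficient is 1 ([act_fused_target]).
*)

Set Implicit Arguments.
Unset Strict Implicit.
Unset Printing Implicit Defensive.

Import GRing.Theory Num.Theory.
Local Open Scope ring_scope.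

(** * Elements of an algebra satisfying the Hecke relations *)

Record hecke_generators (K : fieldType) (q : K) (A : algType K) (l : nat)
    (T : nat -> A) : Prop := HeckeGenerators {
  generators_quadratic i : (0 < i < l)%N -> T i * T i = (q - q^-1) *: T i + 1;
  generators_braid i : (0 < i)%N -> (i.+1 < l)%N ->
    T i * T i.+1 * T i = T i.+1 * T i * T i.+1;
  generators_commute i j : (0 < i)%N -> (i.+1 < j)%N -> (j < l)%N ->
    T i * T j = T j * T i }.

(** The tactic [ac] proves equalities of two sums with the same terms in a
    different order; the coefficients lie in a field and the vectors in a
    noncommutative algebra, which rules out a ring tactic. *)
Lemma ac_step (V : zmodType) (a l r r' : V) : r = a + r' -> l = r' -> a + l = r.
Proof. by move=> -> ->. Qed.
Lemma ac_skip (V : zmodType) (a b r r' : V) : r = a + r' -> b + r = a + (b + r').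
Proof. by move=> ->; rewrite addrCA. Qed.
Ltac ac_find :=
  first [reflexivity | apply: addrC | apply: ac_skip; ac_find].
Ltac ac := rewrite -?addrA;
  repeat (first [reflexivity | eapply ac_step; [ac_find|]]).

Section Blocks.
Variables (K : fieldType) (q : K) (A : algType K) (l : nat) (T : nat -> A).
Hypothesis HT : hecke_generators q l T.
Local Notation s := (q - q^-1).

Let Tquad := generators_quadratic HT.
Let Tbraid := generators_braid HT.
Let Tfar := generators_commute HT.

(** The span of the products of T_lo, ..., T_(hi-1).  An inductive predicate
    serves both uses: commutation with the far generators, and induction on
    elements when they act on words. *)
Inductive generated (lo hi : nat) : A -> Prop :=
  | generated1 : generated lo hi 1
  | generatedT i : (lo <= i < hi)%N -> generated lo hi (T i)
  | generatedZ c a : generated lo hi a -> generated lo hi (c *: a)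
  | generatedD a b :
      generated lo hi a -> generated lo hi b -> generated lo hi (a + b)
  | generatedM a b :
      generated lo hi a -> generated lo hi b -> generated lo hi (a * b).

Lemma generated0 lo hi : generated lo hi 0.
Proof. by rewrite -(scale0r 1); apply: generatedZ; apply: generated1. Qed.

Lemma generated_commute lo hi h g : generated lo hi h ->
  (forall i, (lo <= i < hi)%N -> g * T i = T i * g) -> g * h = h * g.
Proof.
move=> hh hg; elim: hh => {h} [|i|c a _ IH|a b _ IHa _ IHb|a b _ IHa _ IHb].
- by rewrite mulr1 mul1r.
- exact: hg.
- by rewrite -scalerAr IH scalerAl.
- by rewrite mulrDl mulrDr IHa IHb.
- by rewrite mulrA IHa -mulrA IHb mulrA.
Qed.

Lemma generated_sub lo hi lo' hi' a : generated lo hi a ->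
  (lo' <= lo)%N -> (hi <= hi')%N -> generated lo' hi' a.
Proof.
move=> ha h1 h2; elim: ha => {a} [|i ?|c a _ IH|a b _ IHa _ IHb|a b _ IHa _ IHb].
- exact: generated1.
- by apply: generatedT; lia.
- exact: generatedZ.
- exact: generatedD.
- exact: generatedM.
Qed.

Lemma generated_far_l i lo hi h : generated lo hi h ->
  (0 < i)%N -> (i.+1 < lo)%N -> (hi <= l)%N -> T i * h = h * T i.
Proof.
by move=> hh i0 ilo hil; apply: (generated_commute hh) => j ?; apply: Tfar => //; lia.
Qed.

Lemma generated_far_r i lo hi h : generated lo hi h ->
  (0 < lo)%N -> (hi < i)%N -> (i < l)%N -> T i * h = h * T i.
Proof.
by move=> hh i0 ilo hil; apply: (generated_commute hh) => j ?; rewrite -Tfar //; lia.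
Qed.

(** * Coset sums and antisymmetry *)

Fixpoint descend p m : A := if m is m'.+1 then descend p.+1 m' * T p else 1.

(** The sum of (-q)^(i-1) T_(p+m-1) ... T_(p+i) for 1 <= i <= m, an alternating sum
    of coset representatives: multiplying an antisymmetrizer in T_(p+1), ...,
    T_(p+m-2) by it gives one that involves T_(p+m-1) as well. *)
Fixpoint coset_sum p m : A :=
  if m is m'.+1 then descend p.+1 m' - q *: coset_sum p.+1 m' else 0.

Lemma coset_sumS p m :
  coset_sum p m.+1 = descend p.+1 m - q *: coset_sum p.+1 m.
Proof. by []. Qed.

Lemma descendSr p m : descend p m.+1 = descend p.+1 m * T p.
Proof. by []. Qed.

Lemma descendS p m : descend p m.+1 = T (p + m) * descend p m.
Proof.
elim: m p => [|m IH] p; first by rewrite /= addn0 mul1r mulr1.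
by rewrite -[LHS]/(descend p.+1 m.+1 * T p) IH addSnnS -mulrA.
Qed.

Lemma generated_descend p m : generated p (p + m) (descend p m).
Proof.
elim: m p => [|m IH] p; first exact: generated1.
apply: generatedM; last by apply: generatedT; lia.
by apply: generated_sub (IH p.+1) _ _; lia.
Qed.

Lemma generated_coset_sum p m : generated p.+1 (p + m) (coset_sum p m).
Proof.
elim: m p => [|m IH] p; first exact: generated0.
rewrite /= -scaleNr; apply: generatedD; last apply: generatedZ.
  by apply: generated_sub (generated_descend p.+1 m) _ _; lia.
by apply: generated_sub (IH p.+1) _ _; lia.
Qed.

(** The braid relation makes the descending product shift the generators. *)
Lemma descend_shift p m j : (0 < p)%N -> (p + m <= l)%N -> (p <= j)%N ->
  (j.+1 < p + m)%N -> descend p m * T j.+1 = T j * descend p m.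
Proof.
elim: m p => [|m IH] p p0 pml pj jm; first by lia.
case: (ltngtP p j) pj => // [pj|e] _.
  rewrite /= -mulrA [T p * _]Tfar //; try lia.
  by rewrite mulrA IH //; [rewrite mulrA | lia..].
case: m {IH} => [|m] in pml jm *; first by lia.
rewrite -e /= -!mulrA [T p.+1 * _]mulrA -Tbraid //; last lia.
rewrite !mulrA; congr (_ * _ * _).
by symmetry; apply: generated_far_l (generated_descend p.+2 m) _ _ _; lia.
Qed.

Definition antisym p r (h : A) :=
  forall j, (p <= j < r)%N -> h * T j = - q^-1 *: h.

Lemma antisym_mulr p r h g : (forall j, (p <= j < r)%N -> T j * g = g * T j) ->
  antisym p r h -> antisym p r (h * g).
Proof. by move=> c hh j jr; rewrite -mulrA -c // mulrA hh // scalerAl. Qed.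

Hypothesis q0 : q != 0.

(** Two steps of the recursion write the coset sum of length m + 2 as
    D (T_(p+1) - q) + q^2 Q where Q commutes with T_(p+1): the first term
    is killed by T_(p+1) + q^-1, and in the second this factor moves to h.
    For j > p + 1 the descending product turns T_j into T_(j-1). *)
Lemma antisym_coset_sum p m h : (p + m <= l)%N -> antisym p.+1 (p + m).-1 h ->
  antisym p.+1 (p + m) (h * coset_sum p m).
Proof.
elim: m p h => [|m IH] p h pml hh j /andP[pj jm]; first by lia.
case: m IH => [|m] IH in pml hh jm *; first by lia.
have [e|pj'] := leqP j p.+1.
  have {pj e} ? : j = p.+1 by lia.
  subst j.
  have -> : coset_sum p m.+2 = descend p.+2 m * (T p.+1 - q%:A)
       + q ^+ 2 *: coset_sum p.+2 m.
    by rewrite /= mulrBr mulr_algr scalerBr scalerA opprB addrA addrAC.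
  rewrite mulrDr mulrDl scalerDr; congr (_ + _).
    rewrite -!mulrA scalerAr scalerAr; congr (_ * (_ * _)).
    rewrite mulrBl mulr_algl Tquad; last by lia.
    rewrite scalerBr scalerA mulNr mulVf // scaleN1r opprK scalerBl scaleNr.
    by rewrite addrAC [X in X + 1 = _]addrAC subrr add0r.
  case: m {IH} => [|m] in pml hh jm *.
    by rewrite /= scaler0 mulr0 mul0r scaler0.
  rewrite -mulrA -scalerAl -(generated_far_l (i := p.+1) (generated_coset_sum p.+2 m.+1)) //; [|lia].
  by rewrite scalerAr mulrA hh ?scalerAl //; lia.
rewrite coset_sumS [h * _]mulrBr mulrBl [RHS]scalerBr; congr (_ - _).
  case: j pj' pj jm => // j pj' pj jm.
  rewrite -mulrA descend_shift //; try lia.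
  by rewrite mulrA hh ?scalerAl //; lia.
rewrite -scalerAr -scalerAl IH; [|lia| |lia].
  by rewrite !scalerA mulrC.
by move=> i hi; apply: hh; lia.
Qed.

(** * Yang-Baxter and unitarity *)

(** Written as s x / (y - x) rather than s / (y / x - 1), so that the pole of a
    factor can be cleared by y - x. *)
Definition factor_coef (x y : K) := s * x / (y - x).
Definition factor i x y := T i + (factor_coef x y)%:A.

(** The condition on b is the relation between the coefficients of the three
    factors.  It makes the coefficients of X and of Y equal, so that the expansion
    is symmetric under the exchange of X with Y and of a with c, except for
    the term X Y X. *)
Lemma factor_triple_product (X Y : A) a b c : X * X = s *: X + 1 -> b * (s + a + c) = a * c ->
  (X + a%:A) * (Y + b%:A) * (X + c%:A) = X * Y * X + c *: (X * Y) + a *: (Y * X)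
    + (a * c) *: X + (a * c) *: Y + (b + a * b * c)%:A.
Proof.
move=> hX hb.
rewrite !(mulrDl, mulrDr) !(mulr_algl, mulr_algr) -!scalerAl hX.
rewrite !scalerDr !scalerA mul1r -{1}hb !mulrDr !scalerDl.
rewrite [c * a]mulrC [c * b]mulrC [b * a]mulrC [a * c * b]mulrAC.
by ac.
Qed.

Lemma yang_baxter_coef i a b c : (0 < i)%N -> (i.+1 < l)%N ->
    b * (s + a + c) = a * c ->
  (T i.+1 + a%:A) * (T i + b%:A) * (T i.+1 + c%:A) =
  (T i + c%:A) * (T i.+1 + b%:A) * (T i + a%:A).
Proof.
move=> i0 il hb; rewrite !factor_triple_product //; [|by apply: Tquad; lia|
  by rewrite addrAC hb mulrC|by apply: Tquad; lia].
rewrite Tbraid // [c * a]mulrC [c * b * a]mulrAC [c * a]mulrC [a * c * b]mulrAC.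
by ac.
Qed.

Lemma yang_baxter i x y u : (0 < i)%N -> (i.+1 < l)%N ->
    x != y -> u != y -> u != x ->
  factor i.+1 x y * factor i u y * factor i.+1 u x = factor i u x * factor i.+1 u y * factor i x y.
Proof.
move=> i0 il xy uy ux; apply: yang_baxter_coef => //; rewrite /factor_coef.
have ? : y - x != 0 by rewrite subr_eq0 eq_sym.
have ? : y - u != 0 by rewrite subr_eq0 eq_sym.
have ? : x - u != 0 by rewrite subr_eq0 eq_sym.
by field; do ?[apply/andP; split].
Qed.

(** The scalar F(u, x) F(x, u). *)
Definition unitary_coef x u := (u - q ^+ 2 * x) * (u - x / q ^+ 2) / (u - x) ^+ 2.

Lemma factor_unitary i x u : (0 < i < l)%N -> x != u ->
  factor i u x * factor i x u = (unitary_coef x u)%:A.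
Proof.
move=> il xu; rewrite /factor mulrDl mulrDr mulr_algl mulr_algr Tquad //.
have ? : u - x != 0 by rewrite subr_eq0 eq_sym.
have ? : x - u != 0 by rewrite subr_eq0.
have -> : unitary_coef x u = 1 + factor_coef u x * factor_coef x u.
  by rewrite /unitary_coef /factor_coef; field; do ?[apply/andP; split].
have e : s = - (factor_coef x u + factor_coef u x) by rewrite /factor_coef; field; do ?[apply/andP; split].
rewrite {1}e scalerDr scalerA scaleNr !scalerDl scale1r opprD.
rewrite -!addrA [factor_coef x u *: _ + _]addrCA addrA addrCA [factor_coef u x *: _ + _]addrCA.
by congr (_ + _); rewrite -opprD [X in _ + X]addrA addKr.
Qed.

(** * Collapsing the factors of a column *)

Definition box_value (x : K) a := x / q ^+ (2 * a).
Fixpoint column_values x m : seq K :=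
  if m is m'.+1 then box_value x m' :: column_values x m' else [::].

(** Written with box_value x m so that a column of height 0 also has a value,
    q^2 x; with this convention the products over columns telescope without a
    case distinction. *)
Definition last_value x m := q ^+ 2 * box_value x m.

Lemma last_valueS x m : last_value x m.+1 = box_value x m.
Proof.
rewrite /last_value /box_value mulnS exprD.
by field; rewrite q0 expf_neq0.
Qed.

Lemma box_valueS x m : box_value x m.+1 = box_value x m / q ^+ 2.
Proof. by rewrite /box_value mulnS addnC exprD invfM mulrA. Qed.

(** The factors that a new box of value u brings in; the list has the latest box
    first, so that its head carries the lowest index p. *)
Fixpoint desc_prod (r : seq K) p u : A :=
  if r is y :: r' then desc_prod r' p.+1 u * factor p y u else 1.

Lemma generated_desc_prod r p u : generated p (p + size r) (desc_prod r p u).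
Proof.
elim: r p => [|y r IH] p /=; first exact: generated1.
apply: generatedM; first by apply: generated_sub (IH p.+1) _ _; lia.
apply: generatedD; first by apply: generatedT; lia.
by apply: generatedZ; apply: generated1.
Qed.

Lemma desc_prod_cat r1 r2 p u :
  desc_prod (r1 ++ r2) p u = desc_prod r2 (p + size r1) u * desc_prod r1 p u.
Proof.
elim: r1 p => [|y r IH] p /=; first by rewrite addn0 mulr1.
by rewrite IH addSnnS mulrA.
Qed.

Lemma size_column_values x m : size (column_values x m) = m.
Proof. by elim: m => //= m ->. Qed.

Definition block p m x u : A :=
  descend p m + factor_coef (last_value x m) u *: coset_sum p m.

Lemma generated_block p m x u : generated p (p + m) (block p m x u).
Proof.
apply: generatedD; first exact: generated_descend.
by apply: generatedZ; apply: generated_sub (generated_coset_sum p m) _ _.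
Qed.

(** The recursion adds the last box of the column.  Its generator T_p passes
    through the coset sum and acts on h by -q^-1; what is left is the scalar
    identity f (f' - q^-1) = - q f' between the coefficients at the last two
    values, which moves the pole from one value to the next. *)
Lemma desc_prod_block p m x u h : (0 < p)%N -> (p + m <= l)%N ->
  antisym p (p + m).-1 h -> u \notin column_values x m ->
  h * desc_prod (column_values x m) p u = h * block p m x u.
Proof.
elim: m p => [|m IH] p p0 pm hh um.
  by rewrite /block /= scaler0 addr0.
have um' : u \notin column_values x m by move: um; rewrite inE negb_or => /andP[].
have hh' : antisym p.+1 (p.+1 + m).-1 h by move=> i hi; apply: hh; lia.
rewrite /= mulrA IH //; last by lia.
have hQ : h * (coset_sum p.+1 m * T p) = - q^-1 *: (h * coset_sum p.+1 m).
  case: m hh pm {IH um um' hh'} => [|m] hh pm.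
    by rewrite /= mul0r mulr0 scaler0.
  rewrite -(generated_far_l (generated_coset_sum p.+1 m.+1)); [|lia..].
  by rewrite mulrA hh ?scalerAl //; lia.
rewrite /block descendSr coset_sumS last_valueS -mulrA /factor.
rewrite !(mulrDl, mulrDr) !mulr_algr -!(scalerAl, scalerAr) hQ.
rewrite mulrBr scalerBr -!scalerAr !scalerA -!addrA; congr (_ + _).
congr (_ + _); rewrite -scalerDl -scaleNr.
case: m um um' {IH pm hh hh' hQ} => [|m] um um'.
  by rewrite /= !mulr0 !scaler0.
congr (_ *: _); rewrite last_valueS /last_value /factor_coef.
have e : box_value x m = q ^+ 2 * box_value x m.+1 by rewrite -last_valueS.
move: um; rewrite /= !inE e !negb_or => /and3P[n1 n2 _].
by field; rewrite q0 !subr_eq0 n1 n2.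
Qed.

(** Annihilation survives the collapse, with indices shifted by the new box. *)
Lemma antisym_block p m x u h : (0 < p)%N -> (p + m <= l)%N ->
  antisym p (p + m).-1 h -> antisym p.+1 (p + m) (h * block p m x u).
Proof.
move=> p0 pm hh j jm; rewrite mulrDr mulrDl scalerDr; congr (_ + _).
  case: j jm => // j jm.
  by rewrite -mulrA descend_shift ?mulrA ?hh ?scalerAl //; lia.
rewrite -scalerAr -scalerAl (antisym_coset_sum _ _ jm) //.
  by rewrite !scalerA mulrC.
by move=> i hi; apply: hh; lia.
Qed.

(** * The fused product of a diagram *)

(** A diagram under construction is a list of columns, each a height and a value
    at the top, the latest column first. *)
Fixpoint nboxes (cs : seq (nat * K)) : nat :=
  if cs is c :: cs' then (c.1 + nboxes cs')%N else 0%N.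
Fixpoint shape_values (cs : seq (nat * K)) : seq K :=
  if cs is c :: cs' then column_values c.2 c.1 ++ shape_values cs' else [::].

(** The regularized form of [desc_prod] for a diagram. *)
Fixpoint blocks (cs : seq (nat * K)) p u : A :=
  if cs is c :: cs' then blocks cs' (p + c.1)%N u * block p c.1 c.2 u else 1.
Fixpoint col_antisym (cs : seq (nat * K)) p (h : A) : Prop :=
  if cs is c :: cs' then antisym p (p + c.1).-1 h /\ col_antisym cs' (p + c.1)%N h
  else True.

Lemma shape_valuesS m x cs :
  shape_values ((m.+1, x) :: cs) = box_value x m :: shape_values ((m, x) :: cs).
Proof. by []. Qed.

Lemma size_shape_values cs : size (shape_values cs) = nboxes cs.
Proof. by elim: cs => //= c cs IH; rewrite size_cat size_column_values IH. Qed.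

Lemma generated_blocks cs p u : generated p (p + nboxes cs) (blocks cs p u).
Proof.
elim: cs p => [|c cs IH] p /=; first exact: generated1.
apply: generatedM.
  by apply: generated_sub (IH _) _ _; lia.
by apply: generated_sub (generated_block p c.1 c.2 u) _ _; lia.
Qed.

Lemma antisym_mulr_gen p r lo hi h g : generated lo hi g -> (0 < p)%N ->
  (r < lo)%N -> (hi <= l)%N -> antisym p r h -> antisym p r (h * g).
Proof.
move=> hg p0 rlo hil; apply: antisym_mulr => j jr.
by apply: generated_far_l hg _ _ _; lia.
Qed.

Lemma col_antisym_mulr cs p lo hi h g : generated lo hi g -> (0 < lo)%N ->
  (hi < p)%N -> (p + nboxes cs <= l.+1)%N -> col_antisym cs p h ->
  col_antisym cs p (h * g).
Proof.
move=> hg lo0; elim: cs p => [|c cs IH] p //= hip pl [h1 h2]; split.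
  apply: antisym_mulr h1 => j jr.
  by apply: generated_far_r hg _ _ _; lia.
by apply: IH h2; lia.
Qed.

Lemma blocks_desc_prod cs p u h : (0 < p)%N -> (p + nboxes cs <= l)%N ->
  col_antisym cs p h -> u \notin shape_values cs ->
  h * blocks cs p u = h * desc_prod (shape_values cs) p u.
Proof.
elim: cs p => [|c cs IH] p //= p0 pl [h1 h2].
rewrite mem_cat negb_or => /andP[u1 u2].
rewrite desc_prod_cat size_column_values !mulrA IH //; [|lia..].
rewrite desc_prod_block //; first lia.
case: c h1 pl {IH h2 u1} => [[|m] x] /= h1 pl; first by move=> i; lia.
by apply: antisym_mulr_gen (generated_desc_prod _ _ _) _ _ _ h1;
  rewrite ?size_shape_values; lia.
Qed.

Lemma col_antisym_blocks cs p u h : (0 < p)%N -> (p + nboxes cs <= l)%N ->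
  col_antisym cs p h -> col_antisym cs p.+1 (h * blocks cs p u).
Proof.
elim: cs p h => [|c cs IH] p h //= p0 pl [h1 h2]; rewrite mulrA; split.
  apply: antisym_block => //; first lia.
  case: c h1 pl {IH h2} => [[|m] x] /= h1 pl; first by move=> i; lia.
  by apply: antisym_mulr_gen (generated_blocks _ _ _) _ _ _ h1; lia.
apply: (col_antisym_mulr (generated_block p c.1 c.2 u)) => //; first lia.
by apply: (IH (p + c.1)%N) => //; lia.
Qed.

Fixpoint fused (cs : seq (nat * K)) : A :=
  if cs is c :: cs' then
    fused cs' * \prod_(a < c.1) blocks ((a : nat, c.2) :: cs') 1 (box_value c.2 a)
  else 1.

Lemma fused0 x cs : fused ((0%N, x) :: cs) = fused cs.
Proof. by rewrite /= big_ord0 mulr1. Qed.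

Lemma fusedS m x cs : fused ((m.+1, x) :: cs) =
  fused ((m, x) :: cs) * blocks ((m, x) :: cs) 1 (box_value x m).
Proof. by rewrite /= big_ord_recr /= mulrA. Qed.

(** Adding one box at a time at the bottom of the latest column, after opening it
    with height 0. *)
Lemma box_ind (P : seq (nat * K) -> Prop) : P [::] ->
  (forall x cs, P cs -> P ((0%N, x) :: cs)) ->
  (forall m x cs, P ((m, x) :: cs) -> P ((m.+1, x) :: cs)) ->
  forall cs, P cs.
Proof.
move=> h0 h1 h2; elim=> [|[m x] cs IH] //.
by elim: m => [|m IHm]; [apply: h1|apply: h2].
Qed.

Lemma generated_fused cs : generated 1 (nboxes cs) (fused cs).
Proof.
elim/box_ind: cs => [|x cs IH|m x cs IH]; first exact: generated1.
  by rewrite fused0.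
rewrite fusedS; apply: generatedM.
  by apply: generated_sub IH _ _ => //=; lia.
by apply: generated_sub (generated_blocks ((m, x) :: cs) 1 _) _ _.
Qed.

Lemma blocks_cons c cs p u :
  blocks (c :: cs) p u = blocks cs (p + c.1) u * block p c.1 c.2 u.
Proof. by []. Qed.

Hypothesis q_sqr_neq1 : q ^+ 2 != 1.

(** The only pair not inherited from the earlier columns or boxes is that of the
    new box and the one above it.  There the coefficient of the block is -q, which
    makes the block a coset sum starting one index lower. *)
Lemma fused_antisym cs : (nboxes cs <= l)%N -> all (fun c => c.2 != 0) cs ->
  col_antisym cs 1 (fused cs).
Proof.
elim/box_ind: cs => [|x cs IH|m x cs IH] //= ncs /andP[x0 cs0].
  by split; [move=> j; lia|rewrite big_ord0 mulr1; apply: IH].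
rewrite big_ord_recr /= mulrA.
have [h1 h2] : col_antisym ((m, x) :: cs) 1 (fused ((m, x) :: cs)).
  by apply: IH; rewrite /= ?x0 //; lia.
set h := fused cs * _ in h1 h2 *.
have [g1 g2] := @col_antisym_blocks ((m, x) :: cs) 1 (box_value x m) h isT ncs
  (conj h1 h2).
split=> // j jr; have [j1 jm] : (1 <= j)%N /\ (j < m.+1)%N by lia.
have [j2|e] : (2 <= j)%N \/ j = 1 by lia.
  by apply: g1 => /=; lia.
subst j.
have -> : block 1 m x (box_value x m) = coset_sum 0 m.+1.
  rewrite coset_sumS /block -scaleNr; congr (_ + _ *: _).
  rewrite /factor_coef /last_value; have v0 : box_value x m != 0.
    by rewrite /box_value mulf_neq0 ?invr_neq0 ?expf_neq0.
  have n1 : 1 - q ^+ 2 != 0 by rewrite subr_eq0 eq_sym.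
  have -> : box_value x m - q ^+ 2 * box_value x m = (1 - q ^+ 2) * box_value x m by ring.
  by field; rewrite q0 n1 v0.
rewrite mulrA; apply: antisym_coset_sum; [lia| |lia].
apply: (antisym_mulr_gen (generated_blocks cs (1 + m) (box_value x m))); [lia..|].
by move=> i hi; apply: h1 => /=; lia.
Qed.

Fixpoint fusion_product (r : seq K) : A :=
  if r is u :: r' then fusion_product r' * desc_prod r' 1 u else 1.

Lemma fused_fusion_product cs : (nboxes cs <= l)%N -> all (fun c => c.2 != 0) cs ->
  uniq (shape_values cs) -> fused cs = fusion_product (shape_values cs).
Proof.
elim/box_ind: cs => [|x cs IH|m x cs IH] //.
  by rewrite fused0 /= => ? /andP[_ ?]; apply: IH.
rewrite fusedS shape_valuesS cons_uniq.
move=> ncs cs0 /andP[un uu].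
have n' : (nboxes ((m, x) :: cs) <= l)%N by apply: leq_trans ncs => /=; lia.
rewrite blocks_desc_prod //; first by rewrite IH.
by apply: fused_antisym.
Qed.
End Blocks.

(** * Polynomial functions of a scalar, with values in an algebra *)

Section PolyFun.
Variables (K : fieldType) (A : algType K).

(** Scalars are central, so evaluation at u%:A is multiplicative although the
    coefficients do not commute. *)
Definition polynomial_in (f : K -> A) := exists P : {poly A}, forall u, f u = P.[u%:A].

Lemma comm_poly_alg (P : {poly A}) (u : K) : comm_poly P u%:A.
Proof. by rewrite /comm_poly mulr_algl mulr_algr. Qed.

Lemma polynomial_in_const a : polynomial_in (fun=> a).
Proof. by exists a%:P => u; rewrite hornerC. Qed.

Lemma polynomial_in_id : polynomial_in (fun u => u%:A).
Proof. by exists 'X => u; rewrite hornerX. Qed.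

Lemma polynomial_inD f g : polynomial_in f -> polynomial_in g -> polynomial_in (fun u => f u + g u).
Proof. by move=> [P hP] [Q hQ]; exists (P + Q) => u; rewrite hornerD hP hQ. Qed.

Lemma polynomial_inM f g : polynomial_in f -> polynomial_in g -> polynomial_in (fun u => f u * g u).
Proof.
move=> [P hP] [Q hQ]; exists (P * Q) => u.
by rewrite hornerM_comm ?hP ?hQ //; apply: comm_poly_alg.
Qed.

Lemma polynomial_inZ (g : K -> K) f :
  polynomial_in (fun u => (g u)%:A) -> polynomial_in f -> polynomial_in (fun u => g u *: f u).
Proof.
move=> hg /(polynomial_inM hg) [P hP]; exists P => u.
by rewrite -hP mulr_algl.
Qed.

Lemma polynomial_in_scal (p : {poly K}) : polynomial_in (fun u => (p.[u])%:A).
Proof.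
exists (map_poly (in_alg A) p) => u.
by rewrite -[u%:A]/(in_alg A u) horner_map.
Qed.

Lemma polynomial_in_affine (a b : K) : polynomial_in (fun u => (a * u + b)%:A).
Proof.
have [P hP] := polynomial_in_scal (a *: 'X + b%:P); exists P => u.
by rewrite -hP hornerD hornerZ hornerX hornerC.
Qed.

Hypothesis K_infinite : forall r : seq K, exists u, u \notin r.

(** Counting roots fails over a noncommutative ring; but a root at a scalar splits
    off a linear factor, and away from it the other factor vanishes at the same
    scalars. *)
Lemma poly_cofinite_eq0 n (P : {poly A}) (bad : seq K) : (size P <= n)%N ->
  (forall u, u \notin bad -> P.[u%:A] = 0) -> P = 0.
Proof.
elim: n P bad => [|n IH] P bad; first by rewrite leqn0 size_poly_eq0 => /eqP.
move=> sP hP; have [u ub] := K_infinite bad.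
have /factor_theorem [Q PQ] : root P u%:A by apply/rootP; apply: hP.
have [Q00|Q0] := eqVneq Q 0; first by rewrite PQ Q00 mul0r.
suff /eqP : Q = 0 by rewrite (negPf Q0).
apply: (IH Q (u :: bad)).
  by move: sP; rewrite PQ size_Mmonic ?monicXsubC // size_XsubC addn2.
move=> v; rewrite inE negb_or => /andP[vu vb].
have := hP v vb; rewrite PQ hornerM_comm; last exact: comm_poly_alg.
rewrite hornerXsubC -scalerBl mulr_algr => /eqP.
by rewrite scaler_eq0 subr_eq0 (negPf vu) => /eqP.
Qed.

Lemma polynomial_in_cofinite_eq f g (bad : seq K) : polynomial_in f -> polynomial_in g ->
  (forall u, u \notin bad -> f u = g u) -> f =1 g.
Proof.
move=> [P hP] [Q hQ] h u; rewrite hP hQ; apply/eqP; rewrite -subr_eq0 -hornerN -hornerD.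
rewrite (@poly_cofinite_eq0 _ (P - Q) bad (leqnn _)) ?horner0 // => v vb.
by rewrite hornerD hornerN -hP -hQ h // subrr.
Qed.

End PolyFun.

(** * Jucys-Murphy elements *)

Section JucysMurphy.
Variables (K : fieldType) (q : K) (A : algType K) (l : nat) (T : nat -> A).
Hypothesis HT : hecke_generators q l T.
Local Notation s := (q - q^-1).
Let Tquad := generators_quadratic HT.
Let Tbraid := generators_braid HT.
Let Tfar := generators_commute HT.

(** With indices counted from 0: jm k is the element J_(k+1) of the literature. *)
Fixpoint jm k : A := if k is k'.+1 then T k'.+1 * jm k' * T k'.+1 else 1.

Lemma generated_jm k : generated T 1 k.+1 (jm k).
Proof.
elim: k => [|k IH] /=; first exact: generated1.
have ? : generated T 1 k.+2 (T k.+1) by apply: generatedT; lia.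
apply: generatedM => //; apply: generatedM => //.
by apply: generated_sub IH _ _; lia.
Qed.

(** The braid relation is needed for i = k - 1 only; there it is applied on both
    sides of jm (k - 2), which commutes with T_k. *)
Lemma jm_commT i k : (0 < i < k)%N -> (k < l)%N -> T i * jm k = jm k * T i.
Proof.
elim: k i => [|k IH] i ik kl; first by lia.
have [e|ilt] : i = k \/ (0 < i < k)%N by lia.
  subst i; case: k IH ik kl => [|k] IH ik kl //=; have IHk := generated_jm k.
  have c : T k.+2 * jm k = jm k * T k.+2.
    by apply: (generated_far_r HT IHk); lia.
  have br : T k.+1 * T k.+2 * T k.+1 = T k.+2 * T k.+1 * T k.+2.
    by apply: Tbraid; lia.
  rewrite !mulrA br -(mulrA _ (T k.+2) (jm k)) c !mulrA.
  by rewrite -2![in LHS](mulrA (T k.+2 * T k.+1 * jm k)) -br !mulrA.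
have c : T i * T k.+1 = T k.+1 * T i by apply: Tfar; lia.
by rewrite /= !mulrA c -(mulrA _ (T i)) IH; [rewrite mulrA -!mulrA c|lia..].
Qed.

Lemma jm_comm k h : (k < l)%N -> generated T 1 k h -> jm k * h = h * jm k.
Proof.
by move=> kl hh; apply: (generated_commute hh) => i ik; rewrite jm_commT.
Qed.

Local Notation factor := (factor q T).
Local Notation desc_prod := (desc_prod q T).
Local Notation descend := (descend T).

Lemma factor_commute i x y g : T i * g = g * T i -> factor i x y * g = g * factor i x y.
Proof. by move=> c; rewrite /factor mulrDl mulrDr c mulr_algl mulr_algr. Qed.

(** The inverse of [desc_prod] up to a scalar. *)
Fixpoint asc_prod (r : seq K) p u : A :=
  if r is y :: r' then factor p u y * asc_prod r' p.+1 u else 1.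

Lemma generated_factor lo hi i x y : (lo <= i < hi)%N -> generated T lo hi (factor i x y).
Proof.
move=> h; apply: generatedD; first exact: generatedT.
by apply: generatedZ; apply: generated1.
Qed.

Lemma generated_asc_prod r p u : generated T p (p + size r) (asc_prod r p u).
Proof.
elim: r p => [|y r IH] p /=; first exact: generated1.
apply: generatedM; last by apply: generated_sub (IH p.+1) _ _; lia.
by apply: generated_factor; lia.
Qed.

Hypothesis q0 : q != 0.

Lemma asc_desc r p u : (0 < p)%N -> (p + size r <= l)%N -> u \notin r ->
  asc_prod r p u * desc_prod r p u = (\prod_(x <- r) unitary_coef q x u)%:A.
Proof.
elim: r p => [|y r IH] p p0 /= pl; first by rewrite big_nil mul1r scale1r.
rewrite inE negb_or => /andP[uy ur].
rewrite !mulrA -(mulrA (factor p u y)) IH ?addSnnS //.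
rewrite mulr_algr -scalerAl (factor_unitary HT q0) //; [|lia|by rewrite eq_sym].
by rewrite scalerA big_cons mulrC.
Qed.

(** The strand of the box of value u and that of the box of value y cross all
    boxes of the list; Yang-Baxter interchanges the two, one box at a time. *)
Lemma asc_desc_exchange r p u y : (0 < p)%N -> (p + size r < l)%N ->
    y \notin r -> u \notin r -> u != y ->
  desc_prod r p.+1 y * factor p u y * asc_prod r p.+1 u =
  asc_prod r p u * factor (p + size r) u y * desc_prod r p y.
Proof.
elim: r p => [|x r IH] p p0 /= pl; first by rewrite addn0 !mulr1.
rewrite !inE !negb_or => /andP[yx yr] /andP[ux ur] uy.
have pl' : (p.+1 + size r < l)%N by rewrite addSnnS.
have p2l : (p.+1 < l)%N by lia.
rewrite !mulrA -!(mulrA (desc_prod r p.+2 y)).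
rewrite (yang_baxter HT q0) // 1?eq_sym //.
have c1 z1 z2 : factor p z1 z2 * desc_prod r p.+2 y = desc_prod r p.+2 y * factor p z1 z2.
  apply: factor_commute; apply: (generated_far_l HT (generated_desc_prod T q0 r p.+2 y)); lia.
have c2 z1 z2 : factor p z1 z2 * asc_prod r p.+2 u = asc_prod r p.+2 u * factor p z1 z2.
  apply: factor_commute; apply: (generated_far_l HT (generated_asc_prod r p.+2 u)); lia.
rewrite !mulrA -c1 -!(mulrA _ _ (asc_prod _ _ _)) c2 !mulrA.
rewrite -!(mulrA (factor p u x)) IH //.
by rewrite !mulrA addSnnS.
Qed.

Lemma desc_prod_shift X r p y :
  (forall j, (p <= j < p + size r)%N -> T j * X = X * T j.+1) ->
  desc_prod r p y * X = X * desc_prod r p.+1 y.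
Proof.
elim: r p => [|x r IH] p /= hX; first by rewrite mul1r mulr1.
rewrite -mulrA [factor p _ _ * X]mulrDl hX ?mulr_algl; last by lia.
rewrite -[_ *: X]mulr_algr -mulrDr -[T p.+1 + _]/(factor p.+1 x y) mulrA IH ?mulrA //.
by move=> j hj; apply: hX; lia.
Qed.

End JucysMurphy.

(** * The fused product is an eigenvector *)

Section Eigen.
Variables (K : fieldType) (q : K) (A : algType K) (l : nat) (T : nat -> A).
Hypothesis q0 : q != 0.
Hypothesis q_sqr_neq1 : q ^+ 2 != 1.
Hypothesis K_infinite : forall r : seq K, exists u, u \notin r.
Hypothesis HT : hecke_generators q l T.
Local Notation s := (q - q^-1).
Local Notation factor := (factor q T).
Local Notation desc_prod := (desc_prod q T).
Local Notation descend := (descend T).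
Local Notation coset_sum := (coset_sum q T).
Local Notation asc_prod := (asc_prod q T).
Local Notation jm := (jm T).
Local Notation shape_values := (shape_values q).
Local Notation fused := (fused q T).
Local Notation blocks := (blocks q T).
Local Notation box_value := (box_value q).
Local Notation last_value := (last_value q).
Implicit Type cs : seq (nat * K).

(** The product of the poles that remain after the collapse. *)
Definition denom cs u := \prod_(c <- cs) (u - last_value c.2 c.1).

(** [blocks] with denominators cleared, so that it is polynomial in u. *)
Fixpoint blocks_poly cs p u : A :=
  if cs is c :: cs' then
    blocks_poly cs' (p + c.1)%N u *
    ((u - last_value c.2 c.1) *: descend p c.1
      + (s * last_value c.2 c.1) *: coset_sum p c.1)
  else 1.

Lemma denom_cons c cs u : denom (c :: cs) u = (u - last_value c.2 c.1) * denom cs u.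
Proof. by rewrite /denom big_cons. Qed.

Lemma denom_neq0 cs u :
  u \notin [seq last_value c.2 c.1 | c <- cs] -> denom cs u != 0.
Proof.
move=> hu; rewrite /denom prodf_seq_neq0; apply/allP => c cin /=.
by rewrite subr_eq0; apply: contra hu => /eqP ->; apply/mapP; exists c.
Qed.

Lemma denom_own x m cs : x != 0 -> denom cs (box_value x m) != 0 ->
  denom ((m, x) :: cs) (box_value x m) != 0.
Proof.
move=> x0 d0; rewrite denom_cons mulf_neq0 //=.
rewrite /last_value -[X in X - _]mul1r -mulrBl mulf_neq0 //.
  by rewrite subr_eq0 eq_sym.
by rewrite mulf_neq0 ?invr_neq0 ?expf_neq0.
Qed.

Lemma blocks_polyE cs p u : denom cs u != 0 ->
  blocks_poly cs p u = denom cs u *: blocks cs p u.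
Proof.
elim: cs p => [|c cs IH] p; first by rewrite /denom big_nil scale1r.
rewrite denom_cons mulf_eq0 negb_or => /andP[c0 cs0] /=.
rewrite IH // -scalerAl [X in _ = X *: _]mulrC -[RHS]scalerA; congr (_ *: _).
rewrite [RHS]scalerAr /block scalerDr scalerA /factor_coef.
by rewrite [_ * (_ / _)]mulrC divfK.
Qed.

Lemma blocks_poly_polynomial_in cs p : polynomial_in (blocks_poly cs p).
Proof.
elim: cs p => [|c cs IH] p /=; first exact: polynomial_in_const.
apply: polynomial_inM; first exact: IH.
apply: polynomial_inD; last exact: polynomial_in_const.
apply: polynomial_inZ; last exact: polynomial_in_const.
have [P hP] := polynomial_in_affine A 1 (- last_value c.2 c.1).
by exists P => u; rewrite -hP mul1r.
Qed.

(** The values at z = (1, ..., 1): the top box of column b, counted from 0, has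
    content b. *)
Fixpoint staircase cs : Prop :=
  if cs is c :: cs' then c.2 = q ^+ (2 * size cs') /\ staircase cs' else True.

Fixpoint nondegenerate cs : Prop :=
  if cs is c :: cs' then nondegenerate cs' /\
    forall a, (a < c.1)%N -> denom cs' (box_value c.2 a) != 0
  else True.

(** The unitarity scalars of consecutive boxes telescope.  Stated without division,
    so that it holds for columns of height 0 too. *)
Lemma prod_unitary_column x m u : u \notin column_values q x m ->
  (\prod_(y <- column_values q x m) unitary_coef q y u) * ((u - x) * (u - last_value x m)) =
  (u - q ^+ 2 * x) * (u - box_value x m).
Proof.
elim: m => [|m IH] /=.
  rewrite big_nil mul1r /last_value /box_value muln0 divr1.
  by move=> _; ring.
rewrite inE negb_or => /andP[um /IH {}IH].
rewrite big_cons last_valueS // box_valueS; set v := box_value x m in um IH *.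
rewrite -mulrA mulrCA [unitary_coef _ _ _ * _]mulrC mulrA.
have e : unitary_coef q v u = (u - last_value x m) * (u - v / q ^+ 2) / (u - v) ^+ 2 by [].
have n : u - v != 0 by rewrite subr_eq0.
have q20 : q ^+ 2 != 0 by rewrite expf_neq0.
transitivity ((\prod_(y <- column_values q x m) unitary_coef q y u * ((u - x) * (u - last_value x m)))
   * (u - v / q ^+ 2) / (u - v)).
  by rewrite e; field; rewrite q0 n.
by rewrite IH; field; rewrite q0 n.
Qed.

(** The factor u - x of a column cancels against the factor u - q^2 x of the column
    before it; that of the first column, where x = 1, cancels against u - 1. *)
Lemma prod_unitary_staircase cs u : staircase cs -> u \notin shape_values cs ->
  (u - 1) * (\prod_(x <- shape_values cs) unitary_coef q x u) * denom cs u =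
  (u - q ^+ (2 * size cs)) * \prod_(c <- cs) (u - box_value c.2 c.1).
Proof.
elim: cs => [|c cs IH] /=.
  by rewrite /denom !big_nil muln0 !mulr1.
case=> ec /IH{}IH; rewrite mem_cat negb_or => /andP[u1 /IH{}IH].
rewrite denom_cons big_cat big_cons /=.
have := prod_unitary_column u1; move: IH; rewrite -ec mulnS exprD -ec.
set P1 := \prod_(y <- column_values _ _ _) _; set P2 := \prod_(y <- shape_values _) _.
set P3 := \prod_(y <- cs) _.
move=> IH h1.
transitivity (((u - 1) * P2 * denom cs u) * (P1 * (u - last_value c.2 c.1))).
  by ring.
by rewrite IH; transitivity (P1 * ((u - c.2) * (u - last_value c.2 c.1)) * P3);
  [ring | rewrite h1; ring].
Qed.

(** With denominators cleared, (u - J) E times the factors of a new box of value u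
    is E T_n ... T_1 times a polynomial in u that contains the factor
    u - box_value x m; so it vanishes at the value of the new box. *)
Lemma jm_eigen_new_box m x cs (c := (m, x) :: cs) :
    staircase c -> (nboxes c < l)%N -> all (fun c => c.2 != 0) c ->
    denom c (box_value x m) != 0 ->
    (forall u, u \notin shape_values c -> fused c * (u%:A - jm (nboxes c)) =
       (u - 1) *: (fused c * descend 1 (nboxes c) * asc_prod (shape_values c) 1 u)) ->
  jm (nboxes c) * (fused c * blocks c 1 (box_value x m)) =
    box_value x m *: (fused c * blocks c 1 (box_value x m)).
Proof.
move=> hc nl c0 dn hB; set n := nboxes c in nl hB *.
have Ecomm : jm n * fused c = fused c * jm n.
  by apply: (jm_comm HT) => //; apply: generated_fused.
pose g u := (u - q ^+ (2 * size c)) * \prod_(d <- c) (u - box_value d.2 d.1).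
have key u : (u%:A - jm n) * (fused c * blocks_poly c 1 u) =
   g u *: (fused c * descend 1 n).
  pose bad := shape_values c ++ [seq last_value d.2 d.1 | d <- c].
  apply: (@polynomial_in_cofinite_eq _ A K_infinite
    (fun u => (u%:A - jm n) * (fused c * blocks_poly c 1 u))
    (fun u => g u *: (fused c * descend 1 n)) bad).
  - apply: polynomial_inM.
      by apply: polynomial_inD; [exact: polynomial_in_id | exact: polynomial_in_const].
    by apply: polynomial_inM; [exact: polynomial_in_const | exact: blocks_poly_polynomial_in].
  - apply: polynomial_inZ; last exact: polynomial_in_const.
    have [P hP] := polynomial_in_scal A (('X - (q ^+ (2 * size c))%:P) *
       \prod_(d <- c) ('X - (box_value d.2 d.1)%:P)).
    exists P => v; rewrite -hP hornerM hornerXsubC horner_prod.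
    by congr (_ * _)%:A; apply: eq_bigr => d _; rewrite hornerXsubC.
  move=> v; rewrite mem_cat negb_or => /andP[v1 v2].
  have dv : denom c v != 0 by apply: denom_neq0.
  rewrite blocks_polyE // -scalerAr (blocks_desc_prod HT q0) //; last first.
    by apply: (fused_antisym HT q0 q_sqr_neq1) => //; apply: ltnW.
  rewrite -scalerAr mulrA mulrBl mulr_algl Ecomm.
  rewrite -[X in X - _]mulr_algr -mulrBr hB // -scalerAl.
  rewrite -(mulrA _ (asc_prod _ _ _)).
  rewrite (asc_desc HT q0) ?size_shape_values // mulr_algr !scalerA.
  by rewrite /g -prod_unitary_staircase // [in RHS]mulrC mulrA.
have := key (box_value x m); have -> : g (box_value x m) = 0.
  by rewrite /g big_cons /= subrr mul0r mulr0.
rewrite blocks_polyE // -!scalerAr scale0r => /eqP.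
rewrite scaler_eq0 (negPf dn) /= mulrBl mulr_algl subr_eq0.
by move=> /eqP ->.
Qed.

(** Together with [scale_in], clears and restores the scalars in front of two
    factors of [resolvent_exchange]. *)
Lemma scale_out (a d w : K) (X D f U Z F : A) :
  a *: (X * D * f * U) = Z * F * X ->
  a *: (d *: X * D * (w *: f) * U) = Z * (w *: F) * (d *: X).
Proof.
move=> h; rewrite -!(scalerAr, scalerAl) -h !scalerA.
by congr (_ *: _); ring.
Qed.

Lemma scale_in (a d w : K) (X D f U Z F : A) : d != 0 -> w != 0 ->
  a *: (d *: X * D * (w *: f) * U) = Z * (w *: F) * (d *: X) ->
  a *: (X * D * f * U) = Z * F * X.
Proof.
move=> d0 w0; rewrite -!(scalerAr, scalerAl) => h.
apply: (scalerI d0); apply: (scalerI w0); rewrite !scalerA in h *; rewrite [w * d]mulrC -h.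
by congr (_ *: _); ring.
Qed.

(** After Yang-Baxter the product contains E * descend 1 n * asc_prod r 1 u, the
    right side of the identity assumed for E. *)
Lemma resolvent_exchange E r n u v :
    size r = n -> (n.+1 < l)%N -> generated T 1 n E ->
    v \notin r -> u \notin r -> u != v ->
    E * (u%:A - jm n) = (u - 1) *: (E * descend 1 n * asc_prod r 1 u) ->
  (u - 1) *: (E * desc_prod r 1 v * descend 1 n.+1 * factor 1 u v * asc_prod r 2 u)
  = T n.+1 * (u%:A - jm n) * factor n.+1 u v * (E * desc_prod r 1 v).
Proof.
move=> sr nl Egen v1 uc uv hB.
have Ecomm : jm n * E = E * jm n by apply: (jm_comm HT) => //; lia.
have ETcomm : T n.+1 * E = E * T n.+1 by apply: (generated_far_r HT Egen).
have sh : desc_prod r 1 v * descend 1 n.+1 = descend 1 n.+1 * desc_prod r 2 v.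
  apply: (desc_prod_shift q0) => j; rewrite sr => jn.
  by rewrite (descend_shift HT) //; lia.
have sl : (1 + size r < l)%N by rewrite sr.
have ex := asc_desc_exchange HT q0 (r := r) (p := 1) isT sl v1 uc uv.
rewrite descendS add1n in sh *.
rewrite -[E * _ * (T _ * _)]mulrA sh -!mulrA.
rewrite (mulrA (desc_prod _ _ _)) ex sr add1n !mulrA -ETcomm.
rewrite -!(mulrA (T _)) [LHS]scalerAr; congr (_ * _).
rewrite [LHS]scalerAl [X in X * _ = _]scalerAl -hB.
have -> : E * (u%:A - jm n) = (u%:A - jm n) * E.
  by rewrite mulrBr mulrBl mulr_algr mulr_algl Ecomm.
by congr (_ * _); rewrite -!mulrA (factor_commute q (i := n.+1)).
Qed.

(** One step of the recursion of the Jucys-Murphy elements: the terms linear in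
    T_(n+1) cancel, because factor_coef u y * (u - y) = - s u. *)
Lemma resolvent_absorb E n u y : (n.+1 < l)%N -> generated T 1 n.+1 E ->
    jm n * E = y *: E -> u != y ->
  T n.+1 * (u%:A - jm n) * factor n.+1 u y * E = E * (u%:A - jm n.+1).
Proof.
move=> nl Egen hE uy.
have Ecomm : jm n.+1 * E = E * jm n.+1 by apply: (jm_comm HT).
have -> : E * (u%:A - jm n.+1) = (u%:A - jm n.+1) * E.
  by rewrite mulrBr mulrBl mulr_algr mulr_algl Ecomm.
have TT : T n.+1 * T n.+1 = s *: T n.+1 + 1 by apply: (generators_quadratic HT); lia.
have TTE : T n.+1 * (T n.+1 * E) = s *: (T n.+1 * E) + E.
  by rewrite mulrA TT mulrDl mul1r scalerAl.
have facE : factor n.+1 u y * E = T n.+1 * E + factor_coef q u y *: E.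
  by rewrite mulrDl mulr_algl.
have JfacE : jm n * (T n.+1 * E + factor_coef q u y *: E) =
    jm n * (T n.+1 * E) + (factor_coef q u y * y) *: E.
  by rewrite mulrDr -scalerAr hE scalerA.
have cy : factor_coef q u y * y = u * s + u * factor_coef q u y.
  have yu : y - u != 0 by rewrite subr_eq0 eq_sym.
  by rewrite /factor_coef; field; rewrite q0 yu.
rewrite -!mulrA facE mulrBl JfacE mulr_algl !mulrBl mulr_algl.
rewrite mulrBr -scalerAr !mulrDr TTE -!scalerAr cy !scalerDr !scalerA scalerDl.
rewrite [X in X - _]addrAC [X in _ - X]addrC opprD.
by rewrite addrACA subrr add0r /= -!mulrA.
Qed.

(** At generic y this is [resolvent_exchange].  Both sides become polynomial in y
    once the poles of the blocks and the factor y - u are cleared, which gives the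
    identity at the actual value of the new box. *)
Lemma jm_resolvent_new_box m x cs (c := (m, x) :: cs) (c' := (m.+1, x) :: cs) :
    (nboxes c' < l)%N -> all (fun c => c.2 != 0) c ->
    denom c (box_value x m) != 0 ->
    (forall u, u \notin shape_values c -> fused c * (u%:A - jm (nboxes c)) =
       (u - 1) *: (fused c * descend 1 (nboxes c) * asc_prod (shape_values c) 1 u)) ->
    jm (nboxes c) * fused c' = box_value x m *: fused c' ->
  forall u, u \notin shape_values c' -> fused c' * (u%:A - jm (nboxes c')) =
       (u - 1) *: (fused c' * descend 1 (nboxes c') * asc_prod (shape_values c') 1 u).
Proof.
move=> nl c0 dn hB hA u uc'.
have uc : u \notin shape_values c by move: uc'; rewrite shape_valuesS inE negb_or => /andP[].
have uy : u != box_value x m by move: uc'; rewrite shape_valuesS inE negb_or => /andP[].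
have en : nboxes c' = (nboxes c).+1 by [].
rewrite en in nl *.
have nl1 : (1 + nboxes c <= l)%N by apply: ltnW.
have nl0 : (nboxes c <= l)%N by apply: leq_trans nl1.
set n := nboxes c in nl hB hA *.
have E'gen : generated T 1 n.+1 (fused c') by rewrite -en; apply: generated_fused.
have Egen : generated T 1 n (fused c) by apply: generated_fused.
have Ecomm : jm n * fused c = fused c * jm n by apply: (jm_comm HT) => //; lia.
have ETcomm : T n.+1 * fused c = fused c * T n.+1.
  by apply: (generated_far_r HT Egen).
pose lin y := (y - u) *: T n.+1 + (s * u)%:A.
pose lin1 y := (y - u) *: T 1 + (s * u)%:A.
have linE y : u != y -> lin y = (y - u) *: factor n.+1 u y.
  move=> uy'; rewrite /lin /factor scalerDr scalerA /factor_coef [_ * (_ / _)]mulrC divfK //.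
  by rewrite subr_eq0 eq_sym.
have lin1E y : u != y -> lin1 y = (y - u) *: factor 1 u y.
  move=> uy'; rewrite /lin1 /factor scalerDr scalerA /factor_coef [_ * (_ / _)]mulrC divfK //.
  by rewrite subr_eq0 eq_sym.
have lin_poly i : polynomial_in (fun y => (y - u) *: T i + (s * u)%:A).
  apply: polynomial_inD; last exact: polynomial_in_const.
  apply: polynomial_inZ; last exact: polynomial_in_const.
  have [P hP] := polynomial_in_affine A 1 (- u).
  by exists P => v; rewrite -hP mul1r.
have key y : (u - 1) *: (fused c * blocks_poly c 1 y * descend 1 n.+1 *
      lin1 y * asc_prod (shape_values c) 2 u) =
    T n.+1 * (u%:A - jm n) * lin y * (fused c * blocks_poly c 1 y).
  pose bad := u :: shape_values c ++ [seq last_value d.2 d.1 | d <- c].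
  apply: (@polynomial_in_cofinite_eq _ A K_infinite
    (fun y => (u - 1) *: (fused c * blocks_poly c 1 y * descend 1 n.+1 *
      lin1 y * asc_prod (shape_values c) 2 u))
    (fun y => T n.+1 * (u%:A - jm n) * lin y * (fused c * blocks_poly c 1 y)) bad).
  - apply: polynomial_inZ; first exact: polynomial_in_const.
    apply: polynomial_inM; last exact: polynomial_in_const.
    apply: polynomial_inM; last exact: lin_poly.
    apply: polynomial_inM; last exact: polynomial_in_const.
    by apply: polynomial_inM; [exact: polynomial_in_const | exact: blocks_poly_polynomial_in].
  - apply: polynomial_inM.
      by apply: polynomial_inM; [exact: polynomial_in_const | exact: lin_poly].
    by apply: polynomial_inM; [exact: polynomial_in_const | exact: blocks_poly_polynomial_in].
  move=> v; rewrite inE negb_or => /andP[vu].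
  rewrite mem_cat negb_or => /andP[v1 v2].
  have uv : u != v by rewrite eq_sym.
  have dv : denom c v != 0 by apply: denom_neq0.
  rewrite blocks_polyE // -[fused c * (_ *: _)]scalerAr.
  rewrite (blocks_desc_prod HT q0) //; last first.
    by apply: (fused_antisym HT q0 q_sqr_neq1).
  rewrite linE // lin1E //; apply: scale_out.
  apply: (resolvent_exchange (n := n)) => //.
  - by rewrite size_shape_values.
  - exact: hB.
have := key (box_value x m); rewrite blocks_polyE // -[fused c * (_ *: _)]scalerAr.
have wy : box_value x m - u != 0 by rewrite subr_eq0 eq_sym.
rewrite linE // lin1E // => /(scale_in dn wy).
rewrite -[fused c * _]/(fused c * blocks c 1 (box_value x m)) -fusedS => key'.
rewrite -(resolvent_absorb nl E'gen hA uy) -key'.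
by rewrite shape_valuesS /= !mulrA.
Qed.

(** The second conjunct is the resolvent identity that keeps the induction on boxes
    going; it needs room for the generator with index nboxes cs. *)
Lemma jm_fused cs : staircase cs -> nondegenerate cs ->
    (nboxes cs <= l)%N ->
  (\sum_(i < nboxes cs) jm i) * fused cs = (\sum_(x <- shape_values cs) x) *: fused cs
  /\ ((nboxes cs < l)%N -> forall u, u \notin shape_values cs ->
       fused cs * (u%:A - jm (nboxes cs)) =
       (u - 1) *: (fused cs * descend 1 (nboxes cs) * asc_prod (shape_values cs) 1 u)).
Proof.
move=> sc nd; have xs0 c : staircase c -> all (fun c => c.2 != 0) c.
  by elim: c => //= c c' IH [-> /IH ->]; rewrite expf_neq0.
elim/box_ind: cs sc nd => [|x cs IH|m x cs IH] sc nd ncs.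
- split=> [|_ u _]; first by rewrite big_ord0 mul0r big_nil scale0r.
  by rewrite /= !mul1r scalerBl scale1r.
- rewrite fused0; case: sc => _ sc; case: nd => nd _.
  exact: IH.
have n1 : (nboxes ((m, x) :: cs) < l)%N by [].
have sc1 : staircase ((m, x) :: cs) by [].
have nd1 : nondegenerate ((m, x) :: cs).
  by case: nd => nd h; split=> // a am; apply: h; apply: ltnW.
have [hA hB] := IH sc1 nd1 (ltnW n1).
have {}hB := hB n1.
have dn : denom ((m, x) :: cs) (box_value x m) != 0.
  have /= /andP[x0 _] := xs0 _ sc1.
  by apply: denom_own => //; case: nd => _; apply.
have hlast := jm_eigen_new_box sc1 n1 (xs0 _ sc1) dn hB.
rewrite -fusedS in hlast; split.
  have -> : nboxes ((m.+1, x) :: cs) = (nboxes ((m, x) :: cs)).+1 by [].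
  rewrite big_ord_recr shape_valuesS big_cons.
  rewrite mulrDl [RHS]scalerDl [RHS]addrC.
  congr (_ + _); last exact: hlast.
  rewrite fusedS mulrA [RHS]scalerAl.
  exact: (congr1 (fun h => h * blocks ((m, x) :: cs) 1 (box_value x m)) hA).
move=> n2; apply: jm_resolvent_new_box => //; exact: xs0.
Qed.

End Eigen.

(** * The sum of the Jucys-Murphy elements is central *)

Section Central.
Variables (K : fieldType) (q : K) (A : algType K) (l : nat) (T : nat -> A).
Hypothesis HT : hecke_generators q l T.

(** All summands commute with T_i, except the two with indices i - 1 and i, whose sum
    J + T_i J T_i commutes with T_i by the quadratic relation. *)
Lemma jm_sum_commT i : (0 < i < l)%N ->
  T i * (\sum_(k < l) jm T k) = (\sum_(k < l) jm T k) * T i.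
Proof.
move=> il; have i1l : (i.-1 < l)%N by lia.
have il' : (i < l)%N by lia.
rewrite (bigD1 (Ordinal il')) //= (bigD1 (Ordinal i1l)) /=; last first.
  by rewrite -val_eqE /=; lia.
rewrite addrA mulrDr mulrDl; congr (_ + _); last first.
  rewrite mulr_sumr mulr_suml; apply: eq_bigr => k.
  rewrite -!val_eqE /= => /andP[k1 k2].
  have [ik|ik] : (i < k)%N \/ (k.+1 < i)%N by lia.
    by rewrite (jm_commT HT) //; lia.
  by rewrite (generated_far_r HT (generated_jm T k)) //; lia.
case: i il {i1l il'} => // i il /=.
have TT := generators_quadratic HT il.
rewrite mulrDr mulrDl !mulrA TT -(mulrA (_ * jm T i)) TT.
by rewrite !(mulrDl, mulrDr) mul1r mulr1 -!(scalerAl, scalerAr) addrAC.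
Qed.

End Central.

(** * The action on functions of words *)

(** Repeated letters would need a third case in the operators below, so words are
    taken injective. *)
Definition word := {w : nat -> nat | injective w}.

Lemma word_eq (w w' : word) : sval w =1 sval w' -> w = w'.
Proof. by case: w w' => [w hw] [w' hw'] h; apply: eq_exist; apply: funext. Qed.

Definition swap_letters i (w : nat -> nat) : nat -> nat :=
  fun a => if a == i.-1 then w i else if a == i then w i.-1 else w a.

Lemma swap_inj i (w : nat -> nat) : injective w -> injective (swap_letters i w).
Proof.
by move=> hw a b; rewrite /swap_letters; do ![case: eqP => ?]; move/hw; lia.
Qed.

Definition swapw i (w : word) : word :=
  exist _ (swap_letters i (sval w)) (swap_inj (i := i) (svalP w)).

Section WordAction.
Variables (K : fieldType) (q : K).
Local Notation s := (q - q^-1).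

Definition swap_coef (a b : nat) : K := if (b < a)%N then s else 0.

(** The operator on functions dual to the regular representation: T_i exchanges the
    letters at positions i - 1 and i, and adds a multiple of the identity
    when they are in descending order. *)
Definition swap_op i (psi : word -> K) : word -> K :=
  fun w => psi (swapw i w) + swap_coef (sval w i.-1) (sval w i) * psi w.

Lemma swapwK i w : swapw i (swapw i w) = w.
Proof.
apply: word_eq => a /=; rewrite /swap_letters.
by do ![case: eqP => ?]; solve [exfalso; lia | congr (sval w _); lia].
Qed.

Lemma swapw_far i j w : (0 < i)%N -> (i.+1 < j)%N ->
  swapw i (swapw j w) = swapw j (swapw i w).
Proof.
move=> i0 ij; apply: word_eq => a /=; rewrite /swap_letters.
by do ![case: eqP => ?]; solve [exfalso; lia | congr (sval w _); lia].
Qed.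

Lemma swapw_braid i w : (0 < i)%N ->
  swapw i (swapw i.+1 (swapw i w)) = swapw i.+1 (swapw i (swapw i.+1 w)).
Proof.
move=> i0; apply: word_eq => a /=; rewrite /swap_letters /=.
by do ![case: eqP => ?]; solve [exfalso; lia | congr (sval w _); lia].
Qed.

Lemma word_neq (w : word) a b : a != b -> sval w a != sval w b.
Proof. by apply: contra => /eqP /(svalP w) ->. Qed.

Lemma swap_op_quadratic i psi w : (0 < i)%N ->
  swap_op i (swap_op i psi) w = s * swap_op i psi w + psi w.
Proof.
move=> i0; rewrite /swap_op swapwK /= /swap_letters !eqxx.
have -> : (i == i.-1) = false by lia.
have := @word_neq w i i.-1 ltac:(lia); rewrite /swap_coef; case: ltngtP => // _ _.
  by ring.
by ring.
Qed.

Lemma swap_op_far i j psi w : (0 < i)%N -> (i.+1 < j)%N ->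
  swap_op i (swap_op j psi) w = swap_op j (swap_op i psi) w.
Proof.
move=> i0 ij; rewrite /swap_op (swapw_far w i0 ij) /= /swap_letters.
by do ![case: eqP => ?]; solve [exfalso; lia | ring].
Qed.

(** The words on both sides agree by the braid relation for transpositions; the
    coefficients only depend on the order of the three letters. *)
Lemma swap_op_braid i psi w : (0 < i)%N ->
  swap_op i (swap_op i.+1 (swap_op i psi)) w = swap_op i.+1 (swap_op i (swap_op i.+1 psi)) w.
Proof.
case: i => // i _; rewrite /swap_op (@swapw_braid i.+1 w isT) /= /swap_letters /= ?eqxx.
have e1 : (i.+1 == i) = false by lia.
have e2 : (i.+2 == i) = false by lia.
have e3 : (i.+2 == i.+1) = false by lia.
have e4 : (i == i.+1) = false by lia.
have e5 : (i.+1 == i.+2) = false by lia.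
have e6 : (i == i.+2) = false by lia.
rewrite ?(e1, e2, e3, e4, e5, e6) ?eqxx !swapwK /=.
have := @word_neq w i i.+1; rewrite e4 => /(_ isT).
have := @word_neq w i.+1 i.+2; rewrite e5 => /(_ isT).
have := @word_neq w i i.+2; rewrite e6 => /(_ isT).
rewrite /swap_coef.
by case: ltngtP => // h1 _; case: ltngtP => // h2 _; case: ltngtP => // h3 _;
  solve [exfalso; lia | ring].
Qed.
End WordAction.

(** * Non-vanishing of the fused product *)

Section NonVanishing.
Variables (K : fieldType) (q : K) (A : algType K) (l : nat) (T : nat -> A).
Local Notation s := (q - q^-1).
Implicit Type cs : seq (nat * K).

Record word_action (act : A -> (word -> K) -> word -> K) : Prop := WordAction {
  wact1 psi w : act 1 psi w = psi w;
  wactD a b psi w : act (a + b) psi w = act a psi w + act b psi w;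
  wactZ c a psi w : act (c *: a) psi w = c * act a psi w;
  wactM a b psi : act (a * b) psi = act a (act b psi);
  wact0 a w : act a (fun=> 0) w = 0;
  wactT i psi : (0 < i < l)%N -> act (T i) psi = swap_op q i psi }.

Variable act : A -> (word -> K) -> word -> K.
Hypothesis Hact : word_action act.

Section Letter.
Variable k : nat.

(** Positions are tracked for one letter k: the letter appended with the new box. *)
Definition avoids j (w : word) := forall a, (a < j)%N -> sval w a != k.
Definition vanishes j (psi : word -> K) := forall w, avoids j w -> psi w = 0.

(** An element of degree less than n in the generators moves the letter k by less
    than n positions.  The bound is strict in order to give the zero element, such
    as the coset sum of length 0, degree less than 0. *)
Definition lag n (g : A) :=
  forall j psi, vanishes j.+1 psi -> vanishes (j + n) (act g psi).

Lemma vanishes0 psi : vanishes 0 psi -> psi = fun=> 0.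
Proof. by move=> h; apply: funext => w; apply: h. Qed.

Lemma vanishes_le i j psi : (i <= j)%N -> vanishes i psi -> vanishes j psi.
Proof. by move=> ij h w hw; apply: h => a ai; apply: hw; apply: leq_trans ij. Qed.

Lemma lag_le m n g : (m <= n)%N -> lag m g -> lag n g.
Proof.
by move=> mn h j psi /h; apply: vanishes_le; rewrite leq_add2l.
Qed.

Lemma lag1 : lag 1 1.
Proof. by move=> j psi h w; rewrite addn1 (wact1 Hact); apply: h. Qed.

Lemma lag0 n : lag n 0.
Proof. by move=> j psi h w _; rewrite -(scale0r 1) (wactZ Hact) mul0r. Qed.

Lemma lagT i : (0 < i < l)%N -> lag 2 (T i).
Proof.
move=> il j psi h w hw; rewrite (wactT Hact) // /swap_op [X in _ + _ * X]h ?mulr0.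
  rewrite addr0; apply: h => a aj /=; rewrite /swap_letters.
  by do ![case: ifP => ?]; apply: hw; lia.
by move=> a aj; apply: hw; lia.
Qed.

Lemma lagD n a b : lag n a -> lag n b -> lag n (a + b).
Proof.
by move=> ha hb j psi h w hw; rewrite (wactD Hact) (ha _ _ h) // (hb _ _ h) ?addr0.
Qed.

Lemma lagZ n c a : lag n a -> lag n (c *: a).
Proof. by move=> ha j psi h w hw; rewrite (wactZ Hact) (ha _ _ h) ?mulr0. Qed.

Lemma lagMl m n a b : lag m.+1 a -> lag n b -> lag (m + n) (a * b).
Proof.
move=> ha hb j psi /hb; rewrite (wactM Hact).
case e: (j + n)%N => [|i] h.
  by move=> w _; rewrite (vanishes0 h) (wact0 Hact).
by have := ha _ _ h; apply: vanishes_le; lia.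
Qed.

Lemma lagMr m n a b : lag n a -> lag m.+1 b -> lag (m + n) (a * b).
Proof.
move=> ha hb j psi /hb; rewrite (wactM Hact) addnS => /ha.
by apply: vanishes_le; lia.
Qed.

Lemma lag_descend p m : (0 < p)%N -> (p + m <= l)%N -> lag m.+1 (descend T p m).
Proof.
elim: m p => [|m IH] p p0 pm; first exact: lag1.
have h : lag (m + 2) (descend T p.+1 m * T p).
  by apply: lagMl; [apply: IH; lia | apply: lagT; lia].
by rewrite /= -addn2.
Qed.

Lemma lag_coset_sum p m : (p + m <= l)%N -> lag m (coset_sum q T p m).
Proof.
elim: m p => [|m IH] p pm; first exact: lag0.
rewrite coset_sumS -scaleNr; apply: lagD.
  by apply: lag_descend; lia.
by apply: lagZ; apply: lag_le (IH p.+1 _); lia.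
Qed.

Lemma descend_cat p m n : descend T (p + m) n * descend T p m =
  descend T p (m + n).
Proof.
elim: m p => [|m IH] p; first by rewrite addn0 mulr1.
by rewrite /= mulrA addnS -addSn IH.
Qed.

(** The leading term of a block is the full descending product. *)
Lemma lag_blocks cs p u : (0 < p)%N -> (p + nboxes cs <= l)%N ->
  lag (nboxes cs) (blocks q T cs p u - descend T p (nboxes cs)).
Proof.
elim: cs p => [|[m x] cs IH] p p0 pl; first by rewrite /= subrr; apply: lag0.
rewrite blocks_cons -descend_cat /=; move: pl => /= pl.
set n := nboxes cs; set D := descend T p m; set D' := descend T _ n.
have hD' : lag n.+1 D' by apply: lag_descend; rewrite /n; lia.
have hd : lag n (blocks q T cs (p + m) u - D') by apply: IH; rewrite /=; lia.
have hB' : lag n.+1 (blocks q T cs (p + m) u).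
  rewrite -(subrK D' (blocks _ _ _ _ _)); apply: lagD hD'.
  exact: lag_le (leqnSn n) hd.
have -> : blocks q T cs (p + m) u * block q T p m x u - D' * D =
    (blocks q T cs (p + m) u - D') * D +
    blocks q T cs (p + m) u * (factor_coef q (last_value q x m) u *: coset_sum q T p m).
  by rewrite /block mulrDr mulrBl addrAC.
apply: lagD.
  by apply: lagMr => //; apply: lag_descend; lia.
rewrite addnC; apply: lagMl => //; apply: lagZ; apply: lag_coset_sum; lia.
Qed.

Definition guarded (w : word) :=
  (forall a, (a < k)%N -> (sval w a < k)%N) /\ sval w k = k.
Definition agree (psi psi' : word -> K) := forall w, guarded w -> psi w = psi' w.

(** The letters at positions k and beyond are out of reach of T_1, ..., T_(k-1). *)
Lemma agree_generated g psi psi' : (k <= l)%N -> generated T 1 k g ->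
  agree psi psi' -> agree (act g psi) (act g psi').
Proof.
move=> kl hg; elim: hg psi psi' => {g} [|i ik|c a _ IH|a b _ IHa _ IHb|a b _ IHa _ IHb]
  psi psi' h w hw.
- by rewrite !(wact1 Hact) h.
- rewrite !(wactT Hact) ?/swap_op; [|lia|lia]; rewrite [psi w]h //; congr (_ + _).
  apply: h; case: hw => h1 h2; split=> [a ak|] /=; rewrite /swap_letters.
    by do ![case: ifP => ?]; apply: h1; lia.
  by do ![case: ifP => ?]; lia.
- by rewrite !(wactZ Hact) (IH _ _ h).
- by rewrite !(wactD Hact) (IHa _ _ h) ?(IHb _ _ h).
- rewrite !(wactM Hact); apply: IHa hw; exact: IHb h.
Qed.

End Letter.

(** The delta function at the words whose first n letters are n - 1, ..., 0. *)
Definition target n (w : word) : K :=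
  \prod_(a < n) (sval w a == (n.-1 - a)%N)%:R.

Fixpoint cycle_word m (w : word) : word :=
  if m is m'.+1 then cycle_word m' (swapw m w) else w.

Lemma act_descend m psi w : (m < l)%N ->
    (forall a, (a < m)%N -> (sval w a < sval w m)%N) ->
  act (descend T 1 m) psi w = psi (cycle_word m w).
Proof.
elim: m w => [|m IH] w ml hw; first by rewrite /= (wact1 Hact).
rewrite descendS (wactM Hact) add1n (wactT Hact) // /swap_op /swap_coef /=.
rewrite ltnNge ltnW ?hw //= mul0r addr0 IH //; first exact: ltnW.
move=> a am /=; rewrite /swap_letters /= eqxx.
by do ![case: ifP => ?]; [lia|lia|apply: hw; lia].
Qed.

Lemma cycle_wordE m w a : sval (cycle_word m w) a =
  if a == 0%N then sval w m else if (a <= m)%N then sval w a.-1 else sval w a.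
Proof.
elim: m w a => [|m IH] w a /=; first by case: a.
rewrite IH /= /swap_letters /= eqxx.
by case: a => //= a; do ![case: ifP => ?] => //; try lia; congr (sval w _); lia.
Qed.

Lemma target_cycle k w : sval w k = k -> target k.+1 (cycle_word k w) = target k w.
Proof.
move=> wk; rewrite /target big_ord_recl cycle_wordE /= wk subn0 eqxx mul1r.
apply: eq_bigr => a _; rewrite cycle_wordE /= ltn_ord /bump /=.
by congr (_ == _)%:R; have := ltn_ord a; lia.
Qed.

Definition idw : word := exist _ id (fun _ _ e => e).

Hypothesis q0 : q != 0.

(** Evaluation at the identity word applies the factors from left to right: the
    earlier boxes permute the first letters and leave the new letter in place, and
    then the factors of the new box have to move it to the front.  By degree only
    their full descending product can do so. *)
Lemma act_fused_target cs : (nboxes cs <= l)%N ->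
  act (fused q T cs) (target (nboxes cs)) idw = 1.
Proof.
elim/box_ind: cs => [_|x cs IH|m x cs IH].
- by rewrite (wact1 Hact) /target big_ord0.
- by rewrite fused0; apply: IH.
have -> : nboxes ((m.+1, x) :: cs) = (nboxes ((m, x) :: cs)).+1 by [].
set c := (m, x) :: cs => nl; rewrite fusedS (wactM Hact) -/c.
rewrite -[RHS]IH; last exact: ltnW.
apply: (@agree_generated (nboxes c)); [exact: ltnW| | |by split].
  exact: (generated_fused T q0 c).
move=> w [w1 w2]; rewrite -[blocks _ _ _ _ _](subrK (descend T 1 (nboxes c))).
rewrite (wactD Hact) act_descend // ?target_cycle //; last by move=> a ?; rewrite w2 w1.
rewrite (_ : act _ _ _ = 0) ?add0r //.
apply: (@lag_blocks (nboxes c) c 1 (box_value q x m) isT nl 0%N).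
  move=> v hv; rewrite /target big_ord_recl /= subn0.
  by rewrite (negPf (hv 0%N isT)) mul0r.
by move=> a an; have := w1 a an; case: eqP => // ->; rewrite ltnn.
Qed.

Lemma fused_neq0 cs : (nboxes cs <= l)%N -> fused q T cs != 0.
Proof.
move=> /act_fused_target; apply: contra_eq_neq => ->.
by rewrite -(scale0r 1) (wactZ Hact) mul0r eq_sym oner_eq0.
Qed.

End NonVanishing.

Local Open Scope quotient_scope.

(** * Quotients of the free algebra by the Hecke relations *)

Section AlgebraMap.
Variables (K : fieldType) (A : lalgType K) (B : algType K) (f : A -> B).

(** The multiplicative linear maps are all that is used of the quotient of the free
    algebra: the consequences of the relations are derived for an arbitrary one. *)
Record algebra_map : Prop := AlgebraMap {
  amapD x y : f (x + y) = f x + f y;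
  amapM x y : f (x * y) = f x * f y;
  amapZ c x : f (c *: x) = c *: f x;
  amap1 : f 1 = 1 }.
Hypothesis hf : algebra_map.

Lemma amap0 : f 0 = 0.
Proof. by rewrite -(scale0r 1) (amapZ hf) scale0r. Qed.
Lemma amapB x y : f (x - y) = f x - f y.
Proof. by rewrite (amapD hf) -scaleN1r (amapZ hf) scaleN1r. Qed.

Lemma amap_quadratic (q : K) x : q != 0 ->
  f ((x - q%:A) * (x + q^-1%:A)) = 0 -> f x * f x = (q - q^-1) *: f x + 1.
Proof.
move=> q0; rewrite (amapM hf) amapB (amapD hf) !(amapZ hf) (amap1 hf).
rewrite mulrBl !mulrDr !mulr_algl mulr_algr scalerA divff // scale1r.
move=> /eqP; rewrite subr_eq0 => /eqP h1.
have -> : f x * f x = q *: f x + 1 - q^-1 *: f x by rewrite -h1 addrK.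
by rewrite scalerBl addrAC.
Qed.

Lemma amap_braid x y : f (x * y * x - y * x * y) = 0 ->
  f x * f y * f x = f y * f x * f y.
Proof. by rewrite amapB !(amapM hf) => /eqP; rewrite subr_eq0 => /eqP. Qed.

Lemma amap_commutator x y : f (x * y - y * x) = 0 -> f x * f y = f y * f x.
Proof. by rewrite amapB !(amapM hf) => /eqP; rewrite subr_eq0 => /eqP. Qed.

Lemma amap_generated (T : nat -> B) l (I : Type) (r : seq I) (c : I -> K)
    (F : I -> A) : (forall i, generated T 1 l (f (F i))) ->
  generated T 1 l (f (\sum_(i <- r) c i *: F i)).
Proof.
move=> h; elim: r => [|i r IH].
  by rewrite big_nil amap0; apply: generated0.
rewrite big_cons (amapD hf); apply: generatedD => //.
by rewrite (amapZ hf); apply: generatedZ.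
Qed.
End AlgebraMap.

Section FreeQuotient.
Variables (K : fieldType) (q : K) (l : nat) (B : algType K).
Local Notation free_alg := {malg K[{fmonom 'I_l.-1}]}.
Variable f : free_alg -> B.
Hypothesis hf : algebra_map f.
Hypothesis f_rel : forall x, hecke_rel q x -> f x = 0.
Variable T : nat -> B.
Hypothesis fT : forall i : 'I_l.-1, T i.+1 = f (free_gen K i).

Lemma malg_monom_scale (c : K) (m : {fmonom 'I_l.-1}) :
  << c *g m >> = c *: (<< m >> : free_alg).
Proof.
by apply/malgP => k; rewrite mcoeffZ !mcoeffU mulrnAr mulr1.
Qed.

Lemma quotient_generated x : generated T 1 l (f x).
Proof.
rewrite [x]monalgE.
rewrite (eq_bigr (fun k => x@_k *: (<< k >> : free_alg))); last first.
  by move=> k _; exact: malg_monom_scale.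
apply: (amap_generated hf) => -[m]; elim: m => [|i m IH].
  have -> : (<< FMonom [::] >> : free_alg) = 1 by rewrite -fmoneE.
  by rewrite (amap1 hf); apply: generated1.
have -> : (<< FMonom (i :: m) >> : free_alg) = free_gen K i * << FMonom m >>.
  by rewrite malgM_def fgmulUU mulr1 [mmul _ _]fmmulE fmuE.
rewrite (amapM hf); apply: generatedM => //.
by rewrite -fT; apply: generatedT; have := ltn_ord i; lia.
Qed.

Hypothesis q0 : q != 0.

Lemma quotient_hecke_generators : hecke_generators q l T.
Proof.
split=> [i|i|i j].
- case: i => // i il; have il' : (i < l.-1)%N by lia.
  rewrite (fT (Ordinal il')); apply: (amap_quadratic hf q0).
  exact: f_rel (hecke_quadratic q (Ordinal il')).
- case: i => // i _ il; have i1 : (i < l.-1)%N by lia.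
  have i2 : (i.+1 < l.-1)%N by lia.
  rewrite (fT (Ordinal i1)) (fT (Ordinal i2)); apply: (amap_braid hf).
  exact: f_rel (@hecke_braid K q l (Ordinal i1) (Ordinal i2) erefl).
case: i => // i _; case: j => // j ij jl.
have i1 : (i < l.-1)%N by lia.
have i2 : (j < l.-1)%N by lia.
have far : ((Ordinal i1).+2 <= (Ordinal i2))%N || ((Ordinal i2).+2 <= (Ordinal i1))%N.
  by apply/orP; left; rewrite /=; lia.
rewrite (fT (Ordinal i1)) (fT (Ordinal i2)); apply: (amap_commutator hf).
exact: f_rel (@hecke_far K q l (Ordinal i1) (Ordinal i2) far).
Qed.

End FreeQuotient.

(** * The action of the free algebra and of the Hecke algebra on words *)

Section Action.
Variables (K : fieldType) (q : K).
Implicit Types (psi : word -> K) (w : word).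

Lemma swap_op_linear i (I : Type) (r : seq I) (c : I -> K) (F : I -> word -> K) w :
  swap_op q i (fun w => \sum_(j <- r) c j * F j w) w =
  \sum_(j <- r) c j * swap_op q i (F j) w.
Proof.
rewrite /swap_op mulr_sumr -big_split; apply: eq_bigr => j _ /=.
by rewrite mulrDr [X in _ + X]mulrCA.
Qed.

(** [word_action] without the condition on the generators, and for algebras with a
    one-sided scalar structure. *)
Record algebra_action (A : lalgType K) (act : A -> (word -> K) -> word -> K) :
  Prop := AlgebraAction {
  aact1 psi w : act 1 psi w = psi w;
  aactD a b psi w : act (a + b) psi w = act a psi w + act b psi w;
  aactZ c a psi w : act (c *: a) psi w = c * act a psi w;
  aactM a b psi : act (a * b) psi = act a (act b psi);
  aact0 a w : act a (fun=> 0) w = 0 }.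

Section ActRel.
Variables (A : lalgType K) (act : A -> (word -> K) -> word -> K).
Hypothesis hact : algebra_action act.

Lemma aactB a b psi w : act (a - b) psi w = act a psi w - act b psi w.
Proof. by rewrite (aactD hact) -scaleN1r (aactZ hact) mulN1r. Qed.

Lemma aact_braid x y i psi w : (0 < i)%N ->
    (forall psi, act x psi = swap_op q i psi) ->
    (forall psi, act y psi = swap_op q i.+1 psi) ->
  act (x * y * x - y * x * y) psi w = 0.
Proof.
move=> i0 hx hy; rewrite aactB !(aactM hact) !(hx, hy).
by apply/eqP; rewrite subr_eq0; apply/eqP; apply: swap_op_braid.
Qed.

Lemma aact_far x y i j psi w : (0 < i)%N -> (i.+1 < j)%N ->
    (forall psi, act x psi = swap_op q i psi) ->
    (forall psi, act y psi = swap_op q j psi) ->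
  act (x * y - y * x) psi w = 0.
Proof.
move=> i0 ij hx hy; rewrite aactB !(aactM hact) !(hx, hy).
by apply/eqP; rewrite subr_eq0; apply/eqP; apply: swap_op_far.
Qed.

Lemma aact_ideal (S : A -> Prop) x : (forall x, S x -> forall psi w, act x psi w = 0) ->
  two_sided_ideal S x -> forall psi w, act x psi w = 0.
Proof.
move=> hS; elim=> {x} [x /hS //||x y _ hx _ hy|a x _ hx|x a _ hx] psi w.
- by rewrite -(scale0r 1) (aactZ hact) mul0r.
- by rewrite (aactD hact) hx hy addr0.
- rewrite (aactM hact) (_ : act x psi = fun=> 0) ?(aact0 hact) //.
  by apply: funext.
- by rewrite (aactM hact) hx.
Qed.

Hypothesis q0 : q != 0.

Lemma aact_quadratic x i psi w : (0 < i)%N ->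
    (forall psi, act x psi = swap_op q i psi) ->
  act ((x - q%:A) * (x + q^-1%:A)) psi w = 0.
Proof.
move=> i0 hx; rewrite (aactM hact) aactB (aactZ hact) (aact1 hact) hx.
have e v : act (x + q^-1%:A) psi v = swap_op q i psi v + q^-1 * psi v.
  by rewrite (aactD hact) hx (aactZ hact) (aact1 hact).
rewrite {1}/swap_op !e.
rewrite -[RHS](subrr (swap_op q i (swap_op q i psi) w)) [X in _ = _ - X]swap_op_quadratic // /swap_op.
by field.
Qed.
End ActRel.

Section FreeAction.
Variable l : nat.
Local Notation free_alg := {malg K[{fmonom 'I_l.-1}]}.

Definition letters_act (m : seq 'I_l.-1) psi : word -> K :=
  foldr (fun i : 'I_l.-1 => swap_op q i.+1) psi m.

Lemma letters_act_linear m (I : Type) (r : seq I) (c : I -> K)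
    (F : I -> word -> K) w :
  letters_act m (fun w => \sum_(j <- r) c j * F j w) w =
  \sum_(j <- r) c j * letters_act m (F j) w.
Proof.
elim: m w => [|i m IH] w //=; rewrite -swap_op_linear.
by congr (swap_op q _ _ _); apply: funext.
Qed.

(** The linear extension to the free algebra of the action of monomials. *)
Definition free_act (x : free_alg) psi : word -> K :=
  fun w => mmap idfun (fun m : {fmonom 'I_l.-1} => letters_act m psi w) x.

Lemma free_act_gen i psi : free_act (free_gen K i) psi = swap_op q i.+1 psi.
Proof.
by apply: funext => w; rewrite /free_act mmapU /= mul1r fmuE.
Qed.

Lemma free_act_action : algebra_action free_act.
Proof.
split=> [psi w|a b psi w|c a psi w|a b psi|a w].
- by rewrite /free_act mmapU /= mul1r [X in letters_act X](_ : _ = [::]) // fm1.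
- exact: mmapD.
- rewrite /free_act (mmapEw (msuppZ_le _ _)) mmapE big_distrr /=.
  by apply: eq_bigr => k _; rewrite mcoeffZ mulrA.
- apply: funext => w; rewrite /free_act malgME raddf_sum /= [in RHS]mmapE.
  apply: eq_bigr => i _; rewrite raddf_sum /=.
  rewrite [X in letters_act i X](_ : _ = fun w => \sum_(k <- msupp b)
     b@_k * letters_act k psi w); last by apply: funext => v; rewrite mmapE.
  rewrite letters_act_linear mulr_sumr; apply: eq_bigr => j _.
  by rewrite mmapU /= mulrA /letters_act fmM foldr_cat.
rewrite /free_act mmapE big1 // => k _.
rewrite (_ : letters_act _ _ _ = 0) ?mulr0 //.
by elim: (k : seq _) w => //= i m IH w; rewrite /swap_op !IH mulr0 addr0.
Qed.
End FreeAction.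
End Action.

Section HeckeFacts.
Variables (K : fieldType) (q : K) (l : nat).
Hypothesis q0 : q != 0.
Local Notation free_alg := {malg K[{fmonom 'I_l.-1}]}.
Local Notation T := (hecke_T q l).

Definition hecke_pi (x : free_alg) : hecke q l := \pi_(hecke q l) x.

Lemma hecke_pi_map : algebra_map hecke_pi.
Proof.
split=> // [x y|x y|c x]; first exact: hecke_piD.
  by symmetry; apply: hecke_piM.
by symmetry; apply: hecke_piZ.
Qed.

Lemma hecke_pi_ideal (x : free_alg) :
  two_sided_ideal (@hecke_rel K q l) x -> hecke_pi x = 0.
Proof.
move=> hx; rewrite -(amap0 hecke_pi_map).
by apply/eqP; rewrite /hecke_pi hecke_pi_eq subr0; apply/asboolP.
Qed.

Lemma hecke_TE (i : 'I_l.-1) : T i.+1 = hecke_pi (free_gen K i).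
Proof. by rewrite /hecke_T /= valK. Qed.

Lemma hecke_T_generators : hecke_generators q l T.
Proof.
apply: (quotient_hecke_generators hecke_pi_map _ hecke_TE q0) => x hx.
by apply: hecke_pi_ideal; apply: tsi_gen.
Qed.

Lemma hecke_generated (h : hecke q l) : generated T 1 l h.
Proof.
rewrite -[h]reprK -/(hecke_pi (repr h)).
exact: (quotient_generated hecke_pi_map hecke_TE).
Qed.

(** Independence of the representative is [hecke_actE]. *)
Definition hecke_act (h : hecke q l) := free_act q (repr h).

(** The action descends to the Hecke algebra. *)
Lemma free_act_ideal (x : free_alg) psi w :
  two_sided_ideal (@hecke_rel K q l) x -> free_act q x psi w = 0.
Proof.
move=> hx; apply: (aact_ideal (free_act_action q l)) hx psi w => {}x.
case=> [i|i j e|i j e] psi w.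
- by apply: (aact_quadratic (free_act_action q l) q0 (i := i.+1)) => // psi';
    apply: free_act_gen.
- apply: (aact_braid (free_act_action q l) (i := i.+1)) => // psi';
    rewrite free_act_gen // e //.
- case/orP: e => ij.
    apply: (aact_far (free_act_action q l) (i := i.+1) (j := j.+1)) => // psi';
    exact: free_act_gen.
  rewrite -opprB -scaleN1r (aactZ (free_act_action q l)).
  rewrite (aact_far (q := q) (free_act_action q l) (i := j.+1) (j := i.+1)) ?mulr0 //;
    exact: free_act_gen.
Qed.

Lemma hecke_actE (x : free_alg) psi : hecke_act (hecke_pi x) psi = free_act q x psi.
Proof.
apply: funext => w; apply/eqP; rewrite -subr_eq0 -(aactB (free_act_action q l)).
by apply/eqP; apply: free_act_ideal; apply/asboolP; apply: hecke_repr.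
Qed.

Lemma hecke_word_action : word_action q l T hecke_act.
Proof.
have hF := free_act_action q l; have hp := hecke_pi_map.
have piK (h : hecke q l) : hecke_pi (repr h) = h by apply: reprK.
split=> [psi w|a b psi w|c a psi w|a b psi|a w|[|i] psi il] //.
- by rewrite -(amap1 hp) hecke_actE (aact1 hF).
- by rewrite -[a]piK -[b]piK -(amapD hp) !hecke_actE (aactD hF).
- by rewrite -[a]piK -(amapZ hp) !hecke_actE (aactZ hF).
- by rewrite -[a]piK -[b]piK -(amapM hp) !hecke_actE (aactM hF).
- by rewrite /hecke_act (aact0 hF).
have il' : (i < l.-1)%N by lia.
by rewrite (hecke_TE (Ordinal il')) hecke_actE free_act_gen.
Qed.
End HeckeFacts.

(** * Column tableaux *)

Section Diagram.
Local Open Scope nat_scope.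

Definition height (la : seq nat) b := count (fun r => b < r) la.

(** Conjugation of partitions: rows longer than b come first. *)
Lemma mem_diagram la a b : sorted geq la -> (b < nth 0 la a) = (a < height la b).
Proof.
have geq_trans : transitive geq by move=> ? ? ? h1 h2; apply: leq_trans h2 h1.
elim: la a => [|r la IH] a /=; first by rewrite nth_nil.
move=> hs; have hle : all (geq r) la by move: hs; rewrite path_sortedE // => /andP[].
have {}IH a' := IH a' (path_sorted hs); rewrite /height /=.
have [br|rb] := ltnP b r; first by case: a.
have c0 : count (fun r => b < r) la = 0.
  apply/eqP; rewrite -leqn0 leqNgt -has_count; apply/hasPn => x xla.
  by rewrite -leqNgt (leq_trans _ rb) //; exact: (allP hle).
rewrite c0 addn0 ltn0; case: a => [|a] /=; first by rewrite ltnNge rb.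
by rewrite IH /height c0.
Qed.

Lemma height_le la b b' : b <= b' -> height la b' <= height la b.
Proof. by move=> bb; apply: sub_count => r /=; apply: leq_ltn_trans. Qed.

Lemma sum_heights la n : all (fun r => r <= n) la ->
  \sum_(b < n) height la b = sumn la.
Proof.
elim: la => [|r la IH] /=; first by rewrite big1.
move=> /andP[rn /IH <-]; rewrite big_split /=; congr (_ + _).
have -> : \sum_(b < n) (b < r : nat) = minn n r.
  by elim: (n) => [|k IHk]; rewrite ?big_ord0 ?big_ord_recr /= ?IHk; lia.
by apply/minn_idPr.
Qed.

Definition offset la b := \sum_(b' < b) height la b'.

Lemma offsetS la b : offset la b.+1 = offset la b + height la b.
Proof. by rewrite /offset big_ord_recr. Qed.

Lemma offset_le la b b' : b <= b' -> offset la b <= offset la b'.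
Proof.
move=> /subnKC <-; elim: (b' - b) => [|n IH]; first by rewrite addn0.
by rewrite addnS offsetS; apply: leq_trans IH _; apply: leq_addr.
Qed.

(** A strictly increasing function gains at least one at every step, so it has no
    room to exceed the identity. *)
Lemma strict_mono_id n (g : nat -> nat) :
  (forall i j, i < j < n -> g i < g j) -> (forall i, i < n -> g i < n) ->
  forall i, i < n -> g i = i.
Proof.
move=> hm hb; have h i d : i + d < n -> g i + d <= g (i + d).
  elim: d => [|d IH] idn; first by rewrite !addn0.
  have h1 := IH ltac:(lia); have h2 := hm (i + d) (i + d.+1) ltac:(lia); lia.
move=> i il; have h1 := h 0 i il; have h2 := h i (n.-1 - i) ltac:(lia).
have h3 := hb (i + (n.-1 - i)) ltac:(lia).
rewrite add0n in h1; lia.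
Qed.

Section ColumnTableau.
Variables (l : nat) (la : seq nat) (L : tableau l la).
Hypothesis la_part : is_partition_of l la.
Hypothesis L_col : column_tableau L.

Lemma part_sorted : sorted geq la. Proof. by case/and3P: la_part. Qed.
Lemma part_sum : sumn la = l. Proof. by case/and3P: la_part => _ _ /eqP. Qed.

Lemma part_le : all (fun r => r <= l) la.
Proof.
rewrite -part_sum; elim: la => //= r s IH; rewrite leq_addr /=.
by apply: sub_all IH => x /leq_trans; apply; apply: leq_addl.
Qed.

Lemma height_part b : height la b <= l.
Proof.
rewrite -part_sum /height; elim: la => //= r s IH.
by apply: leq_add => //; case: ltnP => //; apply: leq_ltn_trans.
Qed.

Lemma offset_part : offset la l = l.
Proof. by rewrite /offset sum_heights ?part_sum //; exact: part_le. Qed.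

Lemma entry_inj : injective L.
Proof. exact: bij_inj (entry_bij L). Qed.

Lemma ex_box a b : a < height la b ->
  exists x : box la, row_of x = a /\ col_of x = b.
Proof.
rewrite -mem_diagram ?part_sorted // => h.
have al : a < size la by rewrite ltnNge; apply/negP => /(nth_default 0) e; rewrite e in h.
by exists (Tagged (fun a : 'I_(size la) => 'I_(nth 0 la a))
  (Ordinal (h : b < nth 0 la (Ordinal al)))).
Qed.

Lemma box_height (x : box la) : row_of x < height la (col_of x).
Proof.
rewrite -mem_diagram ?part_sorted //; case: x => a b /=.
by rewrite /row_of /col_of /=.
Qed.

Lemma box_ext (x y : box la) : row_of x = row_of y -> col_of x = col_of y -> x = y.
Proof.
case: x y => a b [a' b']; rewrite /row_of /col_of /= => /val_inj e.
by subst a' => /val_inj ->.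
Qed.

Lemma col_entry (x y : box la) : col_of x = col_of y -> row_of x = 0 ->
  L y = (L x + row_of y)%N :> nat.
Proof.
move=> cxy rx; move e : (row_of y) => a.
elim: a y cxy e => [|a IH] y cxy ry.
  by rewrite addn0 (@box_ext x y) // rx ry.
have /ex_box [z [zr zc]] : a < height la (col_of y).
  by apply: ltnW; rewrite -ry; apply: box_height.
case: L_col => _ /(_ z y); rewrite zr zc ry => -> //.
by rewrite (IH z) ?addnS // ?zc.
Qed.

Lemma col_of_lt (x : box la) : col_of x < l.
Proof.
have := box_height x; case: (ltnP (col_of x) l) => // h.
rewrite /height (_ : count _ _ = 0) //; apply/eqP; rewrite -leqn0 leqNgt -has_count.
apply/hasPn => r rl; rewrite -leqNgt; apply: leq_trans h.
exact: (allP part_le).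
Qed.

(** Standardness compares the top boxes of neighbouring columns. *)
Lemma top_entry_lt (x y : box la) : row_of x = 0 -> row_of y = 0 ->
  col_of x < col_of y -> L x < L y.
Proof.
move=> rx ry; move e : (col_of y) => b.
elim: b y ry e => [|b IH] y ry cy //; rewrite ltnS leq_eqVlt => h.
have hb : 0 < height la b.
  apply: leq_trans (height_le la (leqnSn b)).
  by rewrite -cy -ry box_height.
have [z [zr zc]] := ex_box hb.
have zy : L z < L y.
  by case: L_col => /(_ z y) st _; apply: st; right; rewrite zr zc ry cy.
case/orP: h => [/eqP h|h]; last by apply: ltn_trans zy; apply: IH.
by rewrite (@box_ext x z) // ?rx ?zr // h zc.
Qed.

(** The entries of a column are consecutive, so a later column whose top entry
    were among them would share a box with it. *)
Lemma entry_lt_col (x y : box la) : col_of x < col_of y -> L x < L y.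
Proof.
move=> cxy; rewrite ltnNge; apply/negP => yx.
have top (z : box la) : exists2 z0 : box la, row_of z0 = 0 & col_of z0 = col_of z.
  have [|z0 [h1 h2]] := @ex_box 0 (col_of z); last by exists z0.
  have := box_height z; lia.
have [x0 rx cx] := top x; have [y0 ry cy] := top y.
have h0 : L x0 < L y0 by apply: top_entry_lt; rewrite ?cx ?cy.
have hx := col_entry cx rx; have hy := col_entry cy ry.
have hr := box_height x.
have [|z [zr zc]] := @ex_box (L y0 - L x0) (col_of x); first by lia.
have hz := col_entry (etrans cx (esym zc)) rx.
have ezy : L z = L y0 by apply: val_inj; rewrite /= hz zr; lia.
by have := congr1 (@col_of la) (entry_inj ezy); rewrite zc cy; lia.
Qed.

Definition position (x : box la) := offset la (col_of x) + row_of x.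

Lemma position_lt (x y : box la) : L x < L y -> position x < position y.
Proof.
move=> xy; rewrite /position; case: (ltngtP (col_of x) (col_of y)) => [c|c|c].
- have := offset_le la c; rewrite offsetS.
  by have := box_height x; lia.
- by have := entry_lt_col c; lia.
rewrite c ltn_add2l; have [|z [zr zc]] := @ex_box 0 (col_of x).
  by have := box_height x; lia.
by rewrite (col_entry zc zr) (col_entry (etrans zc c) zr) ltn_add2l in xy.
Qed.

(** The condition on the columns forces the entries to increase with the position
    in the reading by columns; hence they are these positions. *)
Lemma column_entry (x : box la) : L x = position x :> nat.
Proof.
have [L' LK L'K] := entry_bij L.
pose g i := if insub i is Some j then position (L' j) else 0.
have gE (i : 'I_l) : g i = position (L' i) by rewrite /g valK.
have gEn i (il : i < l) : g i = position (L' (Ordinal il)) by exact: (gE (Ordinal il)).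
rewrite -(LK x) L'K -gE; symmetry; apply: (@strict_mono_id l) (ltn_ord _) => [i j ij|i il].
  have il : i < l by lia.
  have jl : j < l by lia.
  rewrite (gEn i il) (gEn j jl).
  by apply: position_lt; rewrite !L'K /=; lia.
rewrite (gEn i il) /position.
set y := L' _; have := offset_le la (col_of_lt y); rewrite offsetS offset_part.
by have := box_height y; lia.
Qed.

Lemma contentE (x : box la) : content L (L x) = ((col_of x)%:Z - (row_of x)%:Z)%R.
Proof.
by rewrite /content; case: pickP => [y /eqP /entry_inj -> //|/(_ x)]; rewrite eqxx.
Qed.

End ColumnTableau.

Lemma eq_partitions l la mu : 0 < l -> is_partition_of l la -> is_partition_of l mu ->
  (forall b, b < l -> height la b = height mu b) -> la = mu.
Proof.
move=> l0 hla hmu hh.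
have sz nu : is_partition_of l nu -> size nu = height nu 0.
  case/and3P=> _ n0 _; rewrite /height; elim: nu n0 => //= r nu IH.
  by rewrite inE negb_or => /andP[r0 /IH ->]; rewrite lt0n eq_sym r0.
apply: (@eq_from_nth _ 0) => [|a _]; first by rewrite !sz ?hh.
have key b : (b < nth 0 la a) = (b < nth 0 mu a).
  rewrite !mem_diagram ?(part_sorted hla) ?(part_sorted hmu) //.
  have [/hh -> //|lb] := ltnP b l.
  have h0 nu : is_partition_of l nu -> height nu b = 0.
    move=> hnu; apply/eqP; rewrite -leqn0 leqNgt -has_count; apply/hasPn => r rn.
    by rewrite -leqNgt (leq_trans _ lb) //; exact: (allP (part_le hnu)).
  by rewrite !h0.
apply/eqP; rewrite eqn_leq; apply/andP; split; rewrite leqNgt; apply/negP => h.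
  by move: (key (nth 0 mu a)); rewrite h ltnn.
by move: (key (nth 0 la a)); rewrite h ltnn.
Qed.

End Diagram.

(** * The product over pairs as a product over boxes *)

From mathcomp Require Import mpoly.

Section Sequences.
Variables (K : fieldType) (q : K).

Fixpoint rev_mkseq (g : nat -> K) n :=
  if n is n'.+1 then g n' :: rev_mkseq g n' else [::].

Fixpoint colseq (X : Type) (ht : nat -> nat) (top : nat -> X) n :=
  if n is n'.+1 then (ht n', top n') :: colseq ht top n' else [::].

Lemma nboxes_colseq ht (top : nat -> K) n : nboxes (colseq ht top n) = (\sum_(b < n) ht b)%N.
Proof. by elim: n => [|n IH]; rewrite ?big_ord0 ?big_ord_recr //= IH addnC. Qed.

Lemma size_colseq ht (top : nat -> K) n : size (colseq ht top n) = n.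
Proof. by elim: n => //= n ->. Qed.

Lemma shape_values_colseq ht top g n :
  (forall b a, (b < n)%N -> (a < ht b)%N ->
    g (\sum_(c < b) ht c + a)%N = box_value q (top b) a) ->
  shape_values q (colseq ht top n) = rev_mkseq g (\sum_(b < n) ht b)%N.
Proof.
elim: n => [|n IH] h; first by rewrite big_ord0.
rewrite big_ord_recr /= IH; last by move=> b a bn; apply: h; apply: ltnW.
have := h n; set o := (\sum_(b < n) ht b)%N => {}h.
elim: (ht n) h => [|m IHm] h; first by rewrite addn0.
rewrite addnS /= h // IHm // => a b am; apply: h => //; exact: ltnW.
Qed.

Lemma mem_rev_mkseq g n x : (x \in rev_mkseq g n) <-> exists2 i, (i < n)%N & x = g i.
Proof.
elim: n => [|n IH] /=; first by split=> // -[].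
rewrite inE; split; last first.
  case=> i; rewrite ltnS leq_eqVlt; case/orP=> [/eqP -> ->|il xi].
    by rewrite eqxx.
  by apply/orP; right; apply/IH; exists i.
case/orP=> [/eqP ->|]; first by exists n.
by move=> /IH [i il ->]; exists i => //; apply: ltnW.
Qed.

Lemma uniq_rev_mkseq g n :
  (forall i j, (i < j)%N -> (j < n)%N -> g i != g j) -> uniq (rev_mkseq g n).
Proof.
elim: n => [|n IH] h //=; rewrite IH ?andbT.
  by apply/negP => /mem_rev_mkseq [i il e]; have := h i n il (ltnSn n); rewrite e eqxx.
by move=> i j ij jn; apply: h => //; apply: ltnW.
Qed.

Lemma nondegenerate_colseq ht top n :
    (forall b b', (b <= b')%N -> (ht b' <= ht b)%N) -> q != 0 ->
    (forall b' b a m, (b' < b)%N -> (b < n)%N -> (a < ht b)%N -> ht b' = m.+1 ->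
       box_value q (top b) a != box_value q (top b') m) ->
  nondegenerate q (colseq ht top n).
Proof.
move=> hmono q0; elim: n => [|n IH] //= h; split.
  by apply: IH => b' b a m b'b bn; apply: h => //; apply: ltnW.
move=> a an; rewrite /denom prodf_seq_neq0; apply/allP => c cin /=.
have [b bn ->] : exists2 b, (b < n)%N & c = (ht b, top b).
  elim: (n) cin => [|k IHk] //=; rewrite inE => /orP [ /eqP -> | /IHk [b bk ->] ].
    by exists k.
  by exists b => //; apply: ltnW.
have := hmono b n (ltnW bn); have := h b n a; rewrite /=.
case e : (ht b) => [|m] hh hbn; first by move: an; rewrite (_ : ht n = 0%N) //; lia.
by rewrite last_valueS // subr_eq0; apply: hh.
Qed.
End Sequences.

Section Rewriting.
Variables (K : fieldType) (q : K) (l : nat).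
Local Notation T := (hecke_T q l).

Lemma F_factorE i x y : x != 0 -> F_factor q l i x y = factor q T i x y.
Proof.
move=> x0; rewrite /F_factor /factor; congr (_ + _%:A); rewrite /factor_coef.
have -> : x^-1 * y - 1 = (y - x) / x by rewrite mulrBl divff // mulrC.
by rewrite invf_div mulrA.
Qed.

Lemma desc_prod_rev_mkseq (g : nat -> K) n p u : desc_prod q T (rev_mkseq g n) p u =
  \prod_(i < n) factor q T (p + n - 1 - i) (g i) u.
Proof.
elim: n p => [|n IH] p; first by rewrite big_ord0.
rewrite big_ord_recr /= IH; congr (_ * factor _ _ _ _ _); last by lia.
by apply: eq_bigr => i _; congr (factor _ _ _ _ _); lia.
Qed.

Lemma fusion_product_rev_mkseq (g : nat -> K) n : fusion_product q T (rev_mkseq g n) =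
  \prod_(j < n) \prod_(i < j) factor q T (j - i) (g i) (g j).
Proof.
elim: n => [|n IH]; first by rewrite big_ord0.
rewrite big_ord_recr /= IH desc_prod_rev_mkseq; congr (_ * _).
by apply: eq_bigr => i _; congr (factor _ _ _ _ _); lia.
Qed.

Variables (la : seq nat) (L : tableau l la).

Definition argfun (arg : 'I_l -> K) k := if insub k is Some i then arg i else 0.

Lemma argfunE arg (i : 'I_l) : argfun arg i = arg i.
Proof. by rewrite /argfun valK. Qed.

Lemma F_fun_fusion_product z : (forall i, F_arg q L z i != 0) ->
  F_fun q L z = fusion_product q T (rev_mkseq (argfun (F_arg q L z)) l).
Proof.
move=> hz; rewrite fusion_product_rev_mkseq /F_fun; apply: eq_bigr => j _.
set g := argfun _.
rewrite (big_ord_widen l (fun i => factor q T (j - i) (g i) (g j))); last exact: ltnW.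
apply: eq_bigr => i _; rewrite F_factorE; last exact: hz.
by congr (factor q _ _ _ _); rewrite /g argfunE.
Qed.

End Rewriting.

(** * Regular functions of several variables *)

Section Regularity.
Variables (K : fieldType) (H : algType K) (n : nat).
Variables (S : set ('I_n -> K)) (a : 'I_n -> K).
Hypothesis Sa : S a.

(** [regular_value] for a function that is defined at a itself, with its own value
    there: including a among the points where the identity holds makes the notion
    stable under sums and products. *)
Definition regular_at (f : ('I_n -> K) -> H) :=
  exists (d : mpoly n K) (P : seq (mpoly n K * H)), d.@[a] != 0 /\
    forall z, S z -> d.@[z] *: f z = \sum_(ph <- P) ph.1.@[z] *: ph.2.

Definition mpoly_fun (g : ('I_n -> K) -> K) :=
  exists p : mpoly n K, forall z, g z = p.@[z].

Lemma mpoly_fun_const c : mpoly_fun (fun=> c).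
Proof. by exists (mpolyC n c) => z; rewrite mevalC. Qed.
Lemma mpoly_fun_var i : mpoly_fun (fun z => z i).
Proof. by exists (mpolyX K (mnm1 i)) => z; rewrite mevalXU. Qed.
Lemma mpoly_funM g h : mpoly_fun g -> mpoly_fun h -> mpoly_fun (fun z => g z * h z).
Proof. by move=> [p hp] [p' hp']; exists (p * p') => z; rewrite mevalM hp hp'. Qed.
Lemma mpoly_funB g h : mpoly_fun g -> mpoly_fun h -> mpoly_fun (fun z => g z - h z).
Proof. by move=> [p hp] [p' hp']; exists (p - p') => z; rewrite mevalB hp hp'. Qed.

Lemma regular_at_const h : regular_at (fun=> h).
Proof.
exists 1, [:: (1, h)]; rewrite meval1 oner_neq0; split=> // z _.
by rewrite big_seq1 /= meval1.
Qed.

Lemma regular_atD f g : regular_at f -> regular_at g -> regular_at (fun z => f z + g z).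
Proof.
move=> [d1 [P1 [n1 h1]]] [d2 [P2 [n2 h2]]].
exists (d1 * d2), ([seq (d2 * p.1, p.2) | p <- P1] ++ [seq (d1 * p.1, p.2) | p <- P2]).
rewrite mevalM mulf_neq0 //; split=> // z Sz; rewrite mevalM big_cat !big_map /=.
rewrite scalerDr [in X in X + _]mulrC -!scalerA h1 // h2 // !scaler_sumr.
by congr (_ + _); apply: eq_bigr => p _; rewrite mevalM scalerA.
Qed.

Lemma regular_atM f g : regular_at f -> regular_at g -> regular_at (fun z => f z * g z).
Proof.
move=> [d1 [P1 [n1 h1]]] [d2 [P2 [n2 h2]]].
exists (d1 * d2), [seq (p.1 * r.1, p.2 * r.2) | p <- P1, r <- P2].
rewrite mevalM mulf_neq0 //; split=> // z Sz; rewrite mevalM big_allpairs_dep /=.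
rewrite -scalerA scalerAr scalerAl h1 // h2 // mulr_suml; apply: eq_bigr => p _.
rewrite mulr_sumr; apply: eq_bigr => r _.
by rewrite mevalM -scalerAl -scalerAr scalerA.
Qed.

Lemma regular_at_frac m d h : mpoly_fun m -> mpoly_fun d ->
  (forall z, S z -> d z != 0) -> regular_at (fun z => (m z / d z) *: h).
Proof.
move=> [p hp] [r hr] hd; exists r, [:: (p, h)]; split; first by rewrite -hr hd.
by move=> z Sz; rewrite big_seq1 /= -hp -hr scalerA mulrC divfK // hd.
Qed.

Lemma regular_at_prod m (F : nat -> ('I_n -> K) -> H) :
  (forall i, (i < m)%N -> regular_at (F i)) -> regular_at (fun z => \prod_(i < m) F i z).
Proof.
elim: m => [|m IH] h.
  have -> : (fun z => \prod_(i < 0) F i z) = fun=> 1.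
    by apply: funext => z; rewrite big_ord0.
  exact: regular_at_const.
have -> : (fun z => \prod_(i < m.+1) F i z) = fun z => (\prod_(i < m) F i z) * F m z.
  by apply: funext => z; rewrite big_ord_recr.
by apply: regular_atM; [apply: IH => i im; apply: h; apply: ltnW | apply: h].
Qed.

End Regularity.

(** The extra polynomial e excludes points at which the two functions are not known
    to agree; multiplying numerator and denominator by e makes the identity trivial
    there. *)
Lemma regular_at_regular_value (K : fieldType) (H : algType K) n
    (Z D : set ('I_n -> K)) (a : 'I_n -> K) (e : ('I_n -> K) -> K)
    (f f' : ('I_n -> K) -> H) :
  mpoly_fun e -> e a != 0 ->
  regular_at (fun z => [/\ Z z, D z & e z != 0] \/ z = a) a f' ->
  (forall z, Z z -> D z -> e z != 0 -> f z = f' z) ->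
  regular_value Z D f a (f' a).
Proof.
move=> [r hr] ea [d [P [da h]]] ff'.
exists (r * d), [seq (r * p.1, p.2) | p <- P].
have sumE z : \sum_(ph <- [seq (r * p.1, p.2) | p <- P]) ph.1.@[z] *: ph.2 =
    e z *: \sum_(ph <- P) ph.1.@[z] *: ph.2.
  rewrite big_map scaler_sumr; apply: eq_bigr => p _ /=.
  by rewrite mevalM -hr scalerA.
split=> [|z Zz Dz|]; first by rewrite mevalM -hr mulf_neq0.
  rewrite sumE mevalM -hr -scalerA.
  have [->|ez] := eqVneq (e z) 0; first by rewrite !scale0r.
  by rewrite ff' // h //; left.
rewrite sumE mevalM -hr -h; last by right.
by rewrite !scalerA -mulrA mulVf ?scale1r // mulf_neq0.
Qed.

Section RegularFused.
Variables (K : fieldType) (q : K) (A : algType K) (T : nat -> A) (n : nat).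
Variables (S : set ('I_n -> K)) (a : 'I_n -> K).
Hypothesis Sa : S a.
Hypothesis q0 : q != 0.
Hypothesis q_sqr_neq1 : q ^+ 2 != 1.
Local Notation funs := (('I_n -> K) -> K).
Implicit Type cs : seq (nat * funs).

Definition eval_columns cs z : seq (nat * K) := [seq (c.1, c.2 z) | c <- cs].

Fixpoint all_mpoly_fun cs : Prop :=
  if cs is c :: cs' then mpoly_fun c.2 /\ all_mpoly_fun cs' else True.

Lemma regular_at_blocks cs p u : mpoly_fun u -> all_mpoly_fun cs ->
    (forall z, S z -> denom q (eval_columns cs z) (u z) != 0) ->
  regular_at S a (fun z => blocks q T (eval_columns cs z) p (u z)).
Proof.
move=> hu; elim: cs p => [|c cs IH] p /=; first by move=> _ _; apply: regular_at_const.
case=> hc hcs hd; apply: regular_atM.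
  apply: IH => // z /hd; rewrite denom_cons mulf_eq0 negb_or => /andP[] //.
apply: regular_atD; first exact: regular_at_const.
have hl : mpoly_fun (fun z => last_value q (c.2 z) c.1).
  apply: mpoly_funM; first exact: mpoly_fun_const.
  by apply: mpoly_funM => //; exact: mpoly_fun_const.
apply: regular_at_frac => //; first by apply: mpoly_funM => //; exact: mpoly_fun_const.
  exact: mpoly_funB.
by move=> z /hd; rewrite denom_cons mulf_eq0 negb_or => /andP[].
Qed.

Lemma regular_at_fused cs : all_mpoly_fun cs ->
    (forall z, S z -> nondegenerate q (eval_columns cs z) /\ all (fun c => c.2 != 0) (eval_columns cs z)) ->
  regular_at S a (fun z => fused q T (eval_columns cs z)).
Proof.
elim: cs => [|c cs IH] /=; first by move=> _ _; apply: regular_at_const.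
case=> hc hcs hS; apply: regular_atM.
  by apply: IH => // z /hS [[? _] /andP[]].
apply: (regular_at_prod (F := fun i z =>
  blocks q T ((i, c.2 z) :: eval_columns cs z) 1 (box_value q (c.2 z) i))) => i ic.
apply: (regular_at_blocks (cs := (i, c.2) :: cs)) => //=.
  by apply: mpoly_funM => //; exact: mpoly_fun_const.
by move=> z /hS [[_ /(_ i ic) h] /andP[x0 _]]; apply: (denom_own q0 q_sqr_neq1).
Qed.
End RegularFused.

(** * Uniqueness of the regular value *)

Section Unique.
Variables (K : fieldType) (H : algType K) (n : nat).
Hypothesis K_infinite : forall r : seq K, exists u, u \notin r.

Lemma meval_curve (p : mpoly n K) (a c : 'I_n -> K) :
  exists P : {poly K}, forall t, p.@[fun i => a i + t * c i] = P.[t].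
Proof.
exists (\sum_(m <- msupp p) p@_m *: \prod_i ((a i)%:P + c i *: 'X) ^+ m i) => t.
rewrite mevalE horner_sum; apply: eq_bigr => m _; rewrite hornerZ horner_prod.
by congr (_ * _); apply: eq_bigr => i _;
  rewrite horner_exp hornerD hornerC hornerZ hornerX mulrC.
Qed.

(** Two presentations agree on a line through a that lies in Z and meets D in all but
    finitely many points; as both sides are polynomial on the line, they agree at a. *)
Lemma regular_value_unique (Z D : set ('I_n -> K)) (f : ('I_n -> K) -> H)
    (a c : 'I_n -> K) (bad : seq K) v1 v2 :
    (forall t, Z (fun i => a i + t * c i)) ->
    (forall t, t \notin bad -> D (fun i => a i + t * c i)) ->
  regular_value Z D f a v1 -> regular_value Z D f a v2 -> v1 = v2.
Proof.
move=> hZ hD [d1 [P1 [n1 h1 ->]]] [d2 [P2 [n2 h2 ->]]].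
pose z t := fun i => a i + t * c i.
have za : z 0 = a by apply: funext => i; rewrite /z mul0r addr0.
have pf (d : mpoly n K) (P : seq (mpoly n K * H)) :
    polynomial_in (fun t => d.@[z t] *: \sum_(ph <- P) ph.1.@[z t] *: ph.2).
  have pm (p : mpoly n K) (f' : K -> H) : polynomial_in f' ->
      polynomial_in (fun t => p.@[z t] *: f' t).
    move=> hf'; apply: polynomial_inZ hf'; have [R hR] := meval_curve p a c.
    have [R' hR'] := polynomial_in_scal H R; exists R' => t.
    by rewrite -hR' -hR.
  apply: (pm d); elim: P => [|ph P IH].
    by exists 0 => t; rewrite big_nil horner0.
  have [R hR] := polynomial_inD (pm ph.1 _ (polynomial_in_const ph.2)) IH.
  by exists R => t; rewrite big_cons -hR.
have key0 := @polynomial_in_cofinite_eq _ H K_infinite _ _ bad (pf d2 P1) (pf d1 P2).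
have key : (fun t => d2.@[z t] *: \sum_(ph <- P1) ph.1.@[z t] *: ph.2) 0 =
    (fun t => d1.@[z t] *: \sum_(ph <- P2) ph.1.@[z t] *: ph.2) 0.
  apply: key0 => t tb /=; have zt : Z (z t) := hZ t; have dt := hD t tb.
  by rewrite -h1 // -h2 // !scalerA mulrC.
move: key; rewrite /= za => key.
apply: (scalerI n1); apply: (scalerI n2).
by rewrite !scalerA mulfK // key mulrAC divff // mul1r.
Qed.
End Unique.

(** * The fusion element of a column tableau *)

Section Value.
Variables (K : fieldType) (q : K) (l : nat).
Hypothesis q0 : q != 0.
Hypothesis q_free : forall n, q ^+ n = 1 -> n = 0%N.
Hypothesis natr_inj : forall m n : nat, m%:R = n%:R :> K -> m = n.
Variables (la : seq nat) (L : tableau l la).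
Hypothesis la_part : is_partition_of l la.
Hypothesis L_col : column_tableau L.
Local Notation T := (hecke_T q l).
Local Notation ht := (height la).

Lemma qpow_inj m n : q ^+ m = q ^+ n -> m = n.
Proof.
wlog mn : m n / (m <= n)%N => [hw h|].
  by have [mn|/ltnW nm] := leqP m n; [apply: hw|symmetry; apply: hw].
rewrite -(subnKC mn) exprD -[X in X = _]mulr1 => /(mulfI (expf_neq0 m q0)).
by move=> /esym /q_free ->; rewrite addn0.
Qed.

Lemma q_sqr_neq1 : q ^+ 2 != 1.
Proof. by apply/eqP => /q_free. Qed.

Lemma K_infinite (r : seq K) : exists u, u \notin r.
Proof.
pose s := [seq n%:R : K | n <- iota 0 (size r).+1].
have us : uniq s by rewrite map_inj_uniq ?iota_uniq // => m n; apply: natr_inj.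
apply: contrapT => h; have hs : {subset s <= r}.
  by move=> x _; apply: contrapT => /negP xr; apply: h; exists x.
by have := uniq_leq_size us hs; rewrite size_map size_iota ltnn.
Qed.

(** The common value of the z-coordinates of column b on Z_space; it is a coordinate
    function, hence polynomial. *)
Definition column_var b (z : 'I_l -> K) : K :=
  if [pick x : box la | (row_of x == 0%N) && (col_of x == b)] is Some x
  then z (L x) else 1.

Definition column_top b z := q ^+ (2 * b) * column_var b z.

Lemma mpoly_fun_column_top b : mpoly_fun (column_top b).
Proof.
apply: mpoly_funM; first exact: mpoly_fun_const.
rewrite /column_var; case: pickP => [x _|_]; first exact: mpoly_fun_var.
exact: mpoly_fun_const.
Qed.

Lemma column_varE z x : Z_space L z -> z (L x) = column_var (col_of x) z.
Proof.
rewrite /column_var => hz; case: pickP => [y /andP[_ /eqP yx]|h].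
  by apply: hz; rewrite yx.
have [|y [yr yc]] := @ex_box l la la_part 0 (col_of x).
  by have := box_height la_part x; lia.
by have := h y; rewrite yr yc !eqxx.
Qed.

Lemma F_argE z x : Z_space L z ->
  F_arg q L z (L x) = box_value q (column_top (col_of x) z) (row_of x).
Proof.
move=> hz; rewrite /F_arg contentE // (column_varE x hz) /box_value /column_top.
rewrite mulrBr expfzDr // mulrAC; congr (_ * _).
by rewrite -exprnN.
Qed.

Lemma entry_surj (i : 'I_l) : exists x, L x = i.
Proof. by have [L' _ LK] := entry_bij L; exists (L' i). Qed.

Definition col_index (i : 'I_l) : nat :=
  if [pick x | L x == i] is Some x then col_of x else 0%N.

Lemma col_indexE x : col_index (L x) = col_of x.
Proof.
rewrite /col_index; case: pickP => [y /eqP /(@entry_inj l la L) -> //|/(_ x)].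
by rewrite eqxx.
Qed.

Lemma ht_mono b b' : (b <= b')%N -> (ht b' <= ht b)%N.
Proof. exact: height_le. Qed.

Lemma column_top1 b : column_top b (fun=> 1 : K) = q ^+ (2 * b).
Proof. by rewrite /column_top /column_var; case: pickP; rewrite ?mulr1. Qed.

Lemma colvalP x a y b : x != 0 -> y != 0 ->
  (box_value q x a == box_value q y b) = (x * q ^+ (2 * b) == y * q ^+ (2 * a)).
Proof.
move=> x0 y0; rewrite /box_value eqr_div ?expf_neq0 //.
Qed.

Let g z := argfun (F_arg q L z).

Lemma argsE z b a : Z_space L z -> (b < l)%N -> (a < ht b)%N ->
  g z (\sum_(c < b) ht c + a)%N = box_value q (column_top b z) a.
Proof.
move=> hz bl ha; have [x [xr xc]] := ex_box la_part ha.
have := column_entry la_part L_col x; rewrite /position /offset xr xc => <-.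
by rewrite /g argfunE F_argE // xr xc.
Qed.

Lemma F_arg_neq z (i j : 'I_l) : F_dom q L z -> (i < j)%N ->
  F_arg q L z i != F_arg q L z j.
Proof.
move=> hd ij; have [i0 h] := hd i j ij; apply: contra h => /eqP <-.
by rewrite mulVf // subrr.
Qed.

Definition columns_at (z : 'I_l -> K) := colseq ht (fun b => column_top b z) l.

(** On F_dom the last coordinate may vanish.  The collapsed product is compared with
    F_fun at points where no coordinate does. *)
Definition coord_prod (z : 'I_l -> K) := \prod_i z i.

Lemma mpoly_fun_coord_prod : mpoly_fun coord_prod.
Proof.
exists (\prod_i mpolyX K (mnm1 i)) => z.
by rewrite rmorph_prod; apply: eq_bigr => i _; rewrite /= mevalXU.
Qed.

Lemma nboxes_columns_at z : nboxes (columns_at z) = l.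
Proof. by rewrite nboxes_colseq -[RHS](offset_part la_part). Qed.

Lemma shape_values_columns z : Z_space L z -> shape_values q (columns_at z) = rev_mkseq (g z) l.
Proof.
move=> hz; rewrite (@shape_values_colseq _ q ht _ (g z)) //.
  by congr (rev_mkseq _ _); exact: (offset_part la_part).
by move=> b a; apply: argsE.
Qed.

Lemma columns_at_neq0 z : coord_prod z != 0 ->
  all (fun c => c.2 != 0) (columns_at z).
Proof.
move=> hz; have z0 i : z i != 0.
  by move: hz; rewrite /coord_prod prodf_seq_neq0 => /allP /(_ i); apply; rewrite mem_index_enum.
suff h n : all (fun c => c.2 != 0) (colseq ht (fun b => column_top b z) n) by apply: h.
elim: n => //= n ->; rewrite andbT mulf_neq0 ?expf_neq0 //.
by rewrite /column_var; case: pickP => // _; rewrite oner_neq0.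
Qed.

Lemma uniq_columns_at z : Z_space L z -> F_dom q L z -> uniq (shape_values q (columns_at z)).
Proof.
move=> hz hd; rewrite shape_values_columns //; apply: uniq_rev_mkseq => i j ij jl.
have il : (i < l)%N by apply: ltn_trans jl.
have ei : g z i = F_arg q L z (Ordinal il) by apply: (argfunE _ (Ordinal il)).
have ej : g z j = F_arg q L z (Ordinal jl) by apply: (argfunE _ (Ordinal jl)).
by rewrite ei ej F_arg_neq.
Qed.

Lemma offset_lt b' b a m : (b' < b)%N -> ht b' = m.+1 ->
  (\sum_(c < b') ht c + m < \sum_(c < b) ht c + a)%N.
Proof.
move=> bb hm; have := offset_le la bb; rewrite offsetS hm /offset; lia.
Qed.

(** The last value of an earlier column is the argument of another entry, and on
    F_dom the arguments are pairwise distinct. *)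
Lemma nondegenerate_columns_at z : Z_space L z -> F_dom q L z ->
  nondegenerate q (columns_at z).
Proof.
move=> hz hd; apply: nondegenerate_colseq => //; first exact: ht_mono.
move=> b' b a m bb bl ab hm.
have hi : (\sum_(c < b) ht c + a < l)%N.
  rewrite -[X in (_ < X)%N](offset_part la_part).
  by apply: leq_trans (offset_le la bl); rewrite offsetS /offset; lia.
have hj := offset_lt a bb hm.
rewrite -argsE // -argsE //; [|exact: ltn_trans bl|by rewrite hm].
have hi' : (\sum_(c < b') ht c + m < l)%N by apply: ltn_trans hi.
have e k (kl : (k < l)%N) : g z k = F_arg q L z (Ordinal kl).
  exact: (argfunE _ (Ordinal kl)).
by rewrite (e _ hi) (e _ hi') eq_sym F_arg_neq.
Qed.

(** The last box of an earlier column b' is at least as low as the new box and in an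
    earlier column, so its content is smaller. *)
Lemma nondegenerate_columns_at1 : nondegenerate q (columns_at (fun=> 1 : K)).
Proof.
apply: nondegenerate_colseq => //; first exact: ht_mono.
move=> b' b a m bb bl ab hm; rewrite !column_top1 colvalP ?expf_neq0 //.
rewrite -!exprD; apply/negP => /eqP /qpow_inj.
have := ht_mono (ltnW bb); lia.
Qed.

Lemma staircase_columns_at1 : staircase q (columns_at (fun=> 1 : K)).
Proof.
suff h n : staircase q (colseq ht (fun b => column_top b (fun=> 1 : K)) n) by apply: h.
by elim: n => //= n IH; rewrite size_colseq column_top1.
Qed.

Definition fusion_value := fused q T (columns_at (fun=> 1 : K)).

Lemma F_fun_fused z : Z_space L z -> F_dom q L z -> coord_prod z != 0 ->
  F_fun q L z = fused q T (columns_at z).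
Proof.
move=> hz hd h0; have c0 := columns_at_neq0 h0.
have z0 i : z i != 0.
  by move: h0; rewrite /coord_prod prodf_seq_neq0 => /allP /(_ i); apply; rewrite mem_index_enum.
rewrite F_fun_fusion_product => [|i]; last by rewrite mulf_neq0 ?expfz_neq0.
rewrite (fused_fusion_product (hecke_T_generators l q0) q0 q_sqr_neq1) //.
- by rewrite shape_values_columns.
- by rewrite nboxes_columns_at.
exact: uniq_columns_at.
Qed.

Lemma regular_value_fusion :
  regular_value (Z_space L) (F_dom q L) (F_fun q L) (fun=> 1) fusion_value.
Proof.
apply: (regular_at_regular_value (e := coord_prod)
  (f' := fun z => fused q T (columns_at z))) => //.
- exact: mpoly_fun_coord_prod.
- by rewrite /coord_prod big1 // oner_neq0.
- pose cf := colseq ht column_top l.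
  have eval_columnsE z : eval_columns cf z = columns_at z.
    suff h n : eval_columns (colseq ht column_top n) z = colseq ht (fun b => column_top b z) n.
      exact: h.
    by elim: n => //= n <-.
  have -> : (fun z => fused q T (columns_at z)) = fun z => fused q T (eval_columns cf z).
    by apply: funext => z; rewrite eval_columnsE.
  apply: regular_at_fused => //; [by right|exact: q_sqr_neq1| |].
    suff h n : all_mpoly_fun (colseq ht column_top n) by apply: h.
    by elim: n => //= n IH; split=> //; exact: mpoly_fun_column_top.
  move=> z hz; rewrite eval_columnsE; case: hz => [[hz hd h0]|->].
    by split; [apply: nondegenerate_columns_at|apply: columns_at_neq0].
  split; first exact: nondegenerate_columns_at1.
  by apply: columns_at_neq0; rewrite /coord_prod big1 // oner_neq0.
exact: F_fun_fused.
Qed.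

(** The line used for uniqueness moves the coordinates of column b at speed b.  Two
    entries of equal content lie in different columns, so their arguments
    separate. *)
Lemma F_val_fusion : F_val q L = fusion_value.
Proof.
pose ci (i : 'I_l) : K := (col_index i)%:R.
pose x (i : 'I_l) : K := q ^ (2 * content L i).
(* On the line z_i = 1 + t c_i through (1, ..., 1), [bad] collects the t at which
   a coordinate vanishes or the arguments of some factor meet. *)
pose bad := [seq - (ci i)^-1 | i <- enum 'I_l] ++
  [seq (x j - x i) / (x i * ci i - x j * ci j) | i <- enum 'I_l, j <- enum 'I_l].
rewrite /F_val; apply: xget_unique; first exact: regular_value_fusion.
move=> v hv.
apply: (regular_value_unique K_infinite (c := ci) (bad := bad)) hv regular_value_fusion.
  by move=> t y y' e; rewrite /ci !col_indexE e.
move=> t; rewrite mem_cat negb_or => /andP[t1 t2] i j ij.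
have x0 k : x k != 0 by rewrite expfz_neq0.
have i0 k : 1 + t * ci k != 0.
  apply: contra t1 => /eqP h; apply/mapP; exists k; first by rewrite mem_enum.
  have c0 : ci k != 0.
    by apply/eqP => c0; move/eqP: h; rewrite c0 mulr0 addr0 oner_eq0.
  by apply: (mulIf c0); rewrite mulNr mulVf //; apply/eqP; rewrite -subr_eq0 opprK addrC h.
have a0 : x i * (1 + t * ci i) != 0 by rewrite mulf_neq0.
split; first exact: a0.
rewrite subr_eq0; apply/negP => /eqP h0.
have h : x i * (1 + t * ci i) = x j * (1 + t * ci j).
  by apply: (mulfI (invr_neq0 a0)); rewrite mulVf // [RHS]h0.
have h' : t * (x i * ci i - x j * ci j) = x j - x i.
  apply/eqP; rewrite -subr_eq0; move/eqP: h; rewrite -subr_eq0 => /eqP <-.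
  by apply/eqP; ring.
have [d0|d0] := eqVneq (x i * ci i - x j * ci j) 0; last first.
  move/negP: t2; apply; apply/allpairsP; exists (i, j); split; rewrite ?mem_enum //=.
  by rewrite -h' mulfK.
have xe : x i = x j by move: h'; rewrite d0 mulr0 => /esym/eqP; rewrite subr_eq0 => /eqP.
move: d0; rewrite xe -mulrBr => /eqP; rewrite mulf_eq0 (negPf (x0 j)) /= subr_eq0.
move=> /eqP /natr_inj.
have [y yi] := entry_surj i; have [y' yj] := entry_surj j.
rewrite -yi -yj !col_indexE => cc.
move: xe; rewrite /x -yi -yj !contentE // cc !mulrBr !expfzDr //.
move=> /(mulfI (expfz_neq0 _ q0)); rewrite -!exprnN => /invr_inj /qpow_inj => rr.
have yy : y = y' by apply: box_ext => //; lia.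
by move: ij; rewrite -yi -yj yy ltnn.
Qed.
End Value.

(** * The sum of the powers of q over the contents *)

Section ContentSum.
Variables (K : fieldType) (q : K).
Hypothesis q0 : q != 0.

Lemma sum_column_values x m : (q ^+ 2 - 1) * (\sum_(y <- column_values q x m) y) =
  q ^+ 2 * (x - box_value q x m).
Proof.
have q20 : q ^+ 2 != 0 by rewrite expf_neq0.
elim: m => [|m IH]; first by rewrite /= big_nil /box_value muln0 divr1 subrr !mulr0.
rewrite /= big_cons mulrDr IH box_valueS.
by field.
Qed.

(** The sum of q^(2c) over the contents c of the diagram with column heights ht. *)
Definition contents_sum (ht : nat -> nat) n : K :=
  \sum_(x <- shape_values q (colseq ht (fun b => q ^+ (2 * b)) n)) x.

Lemma contents_sumE ht n : (q ^+ 2 - 1) * contents_sum ht n =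
  q ^+ 2 * (\sum_(b < n) q ^+ (2 * b) - \sum_(b < n) q ^+ (2 * b) / q ^+ (2 * ht b)).
Proof.
rewrite -sumrB; elim: n => [|n IH].
  by rewrite /contents_sum /= big_nil big_ord0 !mulr0.
have -> : contents_sum ht n.+1 =
    \sum_(y <- column_values q (q ^+ (2 * n)) (ht n)) y + contents_sum ht n.
  by rewrite /contents_sum /= big_cat.
by rewrite big_ord_recr [RHS]mulrDr -IH [RHS]addrC [LHS]mulrDr sum_column_values.
Qed.

(** Shifted by n so that only natural exponents occur. *)
Lemma contents_sum_eq (ht ht' : nat -> nat) n : q ^+ 2 != 1 ->
    (forall b, (b < n)%N -> (ht b <= n)%N) -> (forall b, (b < n)%N -> (ht' b <= n)%N) ->
  contents_sum ht n = contents_sum ht' n ->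
  \sum_(b < n) q ^+ (2 * (b + (n - ht b))) = \sum_(b < n) q ^+ (2 * (b + (n - ht' b))).
Proof.
move=> q_sqr_neq1 h1 h2 e.
have := contents_sumE ht n; rewrite e contents_sumE.
move=> /(mulfI (expf_neq0 2 q0)) /addrI /oppr_inj /esym e1.
have aux (k : nat -> nat) : (forall b, (b < n)%N -> (k b <= n)%N) ->
    \sum_(b < n) q ^+ (2 * (b + (n - k b))) =
    q ^+ (2 * n) * \sum_(b < n) q ^+ (2 * b) / q ^+ (2 * k b).
  move=> hk; rewrite mulr_sumr; apply: eq_bigr => b _.
  have kb := hk b (ltn_ord b).
  apply: (mulIf (expf_neq0 (2 * k b) q0)).
  rewrite mulrA divfK ?expf_neq0 // -!exprD; congr (_ ^+ _).
  by rewrite -!mulnDr addnC; congr (2 * _)%N; lia.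
by rewrite !aux // e1.
Qed.
End ContentSum.

(** The exponents are the indices of the nonzero coefficients, listed in increasing
    order. *)
Lemma sum_Xn_inj (R : numDomainType) (e e' : nat -> nat) n :
    (forall b, (b.+1 < n)%N -> (e b < e b.+1)%N) ->
    (forall b, (b.+1 < n)%N -> (e' b < e' b.+1)%N) ->
    \sum_(b < n) 'X^(e b) = \sum_(b < n) 'X^(e' b) :> {poly R} ->
  forall b, (b < n)%N -> e b = e' b.
Proof.
move=> he he' E.
have sort (f : nat -> nat) : (forall b, (b.+1 < n)%N -> (f b < f b.+1)%N) ->
    sorted ltn [seq f b | b <- iota 0 n].
  move=> hf; apply/(sortedP 0%N) => i; rewrite size_map size_iota => il.
  by rewrite !(nth_map 0%N) ?size_iota ?nth_iota ?add0n //; [apply: hf|apply: ltnW|apply: ltnW].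
have mem (f : nat -> nat) k : (k \in [seq f b | b <- iota 0 n]) =
    ((\sum_(b < n) 'X^(f b) : {poly R})`_k != 0).
  rewrite coef_sum (eq_bigr (fun b : 'I_n => (k == f b : nat)%:R)); last first.
    by move=> b _; rewrite coefXn.
  rewrite -natr_sum pnatr_eq0 sum_nat_eq0; apply/idP/idP => [/mapP[b]|].
    rewrite mem_iota add0n => /= bn ->; apply/forallPn.
    by exists (Ordinal bn); rewrite /= eqxx.
  case/forallPn => b /=; rewrite eqb0 negbK => /eqP ->.
  by apply: map_f; rewrite mem_iota add0n /=.
have eqs : [seq e b | b <- iota 0 n] = [seq e' b | b <- iota 0 n].
  apply: (@irr_sorted_eq _ ltn) => //; [exact: ltn_trans|exact: ltnn|exact: sort|exact: sort|].
  by move=> k; rewrite !mem E.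
move=> b bn; have := congr1 (fun s => nth 0%N s b) eqs.
by rewrite !(nth_map 0%N) ?size_iota // nth_iota.
Qed.

Section GenericParameter.
Variable R : realType.
Local Notation K := (Cq R).
Local Notation q := (qC R).

Lemma qCX n : q ^+ n = tofrac ('X^n : {poly R[i]}).
Proof. by rewrite /qC -rmorphXn. Qed.

Lemma qC_neq0 : q != 0.
Proof. by rewrite /qC tofrac_eq0 polyX_eq0. Qed.

Lemma qC_free n : q ^+ n = 1 -> n = 0%N.
Proof.
rewrite qCX -tofrac1 => /eqP; rewrite tofrac_eq => /eqP /(congr1 (fun p : {poly R[i]} => size p)).
by rewrite size_polyXn size_poly1 => -[].
Qed.

Lemma Cq_nat_inj (m n : nat) : m%:R = n%:R :> K -> m = n.
Proof.
rewrite -!(rmorph_nat (@tofrac {poly R[i]})) => /eqP; rewrite tofrac_eq.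
by rewrite -!polyC_natr => /eqP /polyC_inj /eqP; rewrite eqr_nat => /eqP.
Qed.

Lemma contents_sum_heights l la mu : (0 < l)%N ->
    is_partition_of l la -> is_partition_of l mu ->
    contents_sum q (height la) l = contents_sum q (height mu) l -> la = mu.
Proof.
move=> l0 hla hmu e.
have q21' : q ^+ 2 != 1 by apply/eqP => /qC_free.
apply: (eq_partitions l0 hla hmu).
have hl nu : is_partition_of l nu -> forall b, (b < l)%N -> (height nu b <= l)%N.
  by move=> hnu b _; exact: height_part hnu b.
have := contents_sum_eq qC_neq0 q21' (hl _ hla) (hl _ hmu) e.
under eq_bigr do rewrite qCX.
under [RHS]eq_bigr do rewrite qCX.
rewrite -!(raddf_sum (@tofrac {poly R[i]})) => /eqP; rewrite tofrac_eq => /eqP.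
have mono nu b : (b.+1 < l)%N -> (2 * (b + (l - height nu b)) < 2 * (b.+1 + (l - height nu b.+1)))%N.
  by move=> bl; have := height_le nu (leqnSn b); lia.
move=> /(sum_Xn_inj (e := fun b => (2 * (b + (l - height la b)))%N)
  (e' := fun b => (2 * (b + (l - height mu b)))%N) (mono la) (mono mu)) h b bl.
by have := h b bl; have := hl _ hla b bl; have := hl _ hmu b bl; lia.
Qed.

End GenericParameter.

(** * Separating the left ideals *)

Section Modules.
Variables (R : realType) (l : nat).
Local Notation K := (Cq R).
Local Notation q := (qC R).
Local Notation T := (hecke_T q l).
Local Notation H := (hecke q l).

Definition jm_total : H := \sum_(k < l) jm T k.

Lemma jm_total_central h : jm_total * h = h * jm_total.
Proof.
apply: (generated_commute (hecke_generated h)) => i il.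
by rewrite /jm_total (jm_sum_commT (hecke_T_generators l (qC_neq0 R))).
Qed.

Variables (la : seq nat) (L : tableau l la).
Hypothesis la_part : is_partition_of l la.
Hypothesis L_col : column_tableau L.

Let columns := colseq (height la) (fun b => q ^+ (2 * b)) l.

Let columnsE : columns_at q L (fun=> 1) = columns.
Proof.
rewrite /columns_at; congr (colseq _ _ _).
by apply: funext => b; rewrite column_top1.
Qed.

Let F_valE : F_val q L = fused q T columns.
Proof.
rewrite (F_val_fusion (qC_neq0 R) (@qC_free R) (@Cq_nat_inj R) la_part L_col).
by rewrite /fusion_value columnsE.
Qed.

Let nb : nboxes columns = l.
Proof. by rewrite nboxes_colseq -[RHS](offset_part la_part). Qed.

Lemma jm_total_F_val : jm_total * F_val q L = contents_sum q (height la) l *: F_val q L.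
Proof.
have q21' : q ^+ 2 != 1 by apply/eqP => /qC_free.
have HT := hecke_T_generators l (qC_neq0 R).
have sc : staircase q columns by rewrite -columnsE; apply: staircase_columns_at1.
have nd : nondegenerate q columns.
  rewrite -columnsE.
  exact: (nondegenerate_columns_at1 (qC_neq0 R) (@qC_free R) L la_part).
have nl : (nboxes columns <= l)%N by rewrite nb.
have [h _] := jm_fused (qC_neq0 R) q21' (K_infinite (@Cq_nat_inj R)) HT sc nd nl.
by rewrite F_valE -h nb.
Qed.

Lemma F_val_neq0 : F_val q L != 0.
Proof.
rewrite F_valE; apply: (fused_neq0 (hecke_word_action l (qC_neq0 R)) (qC_neq0 R)).
by rewrite nb.
Qed.
End Modules.

(** A central z acting on the generator b by d acts on the whole left ideal by d; the
    image of the generator a is therefore killed by c - d, and it is not zero. *)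
Lemma left_ideal_scalar (K : fieldType) (A : algType K) (z a b : A) (c d : K) :
    (forall h, z * h = h * z) -> z * a = c *: a -> z * b = d *: b -> a != 0 ->
  equivalent_modules (left_ideal_mod a) (left_ideal_mod b) -> c = d.
Proof.
move=> zc za zb a0 [f bf].
have ain : a \in left_ideal a by apply/asboolP; exists 1; rewrite mul1r.
pose u : left_ideal_mod a := LeftIdealMod ain.
have Zu : z *: u = c%:A *: u.
  apply: val_inj; rewrite !linearZ /=.
  by apply: (etrans za); rewrite -[LHS]mulr_algl.
have /asboolP [k fu] := left_ideal_valP (f u).
have /(congr1 val) : z *: f u = c%:A *: f u by rewrite -!linearZ Zu.
rewrite !linearZ /= => Zfu.
have {}Zfu : z * left_ideal_val (f u) = c%:A * left_ideal_val (f u) by exact: Zfu.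
move: Zfu; rewrite fu mulr_algl mulrA zc -mulrA zb -scalerAr => /eqP.
rewrite -subr_eq0 -scalerBl scaler_eq0 => /orP[]; first by rewrite subr_eq0 => /eqP.
rewrite -fu => /eqP fu0.
have : f u = 0 by apply: val_inj; rewrite linear0.
rewrite -(linear0 f) => /(bij_inj bf) /(congr1 val); rewrite linear0 /= => a00.
by rewrite a00 eqxx in a0.
Qed.

Theorem corollary3p6 (R : realType) (l : nat) (l_gt0 : (0 < l)%N)
    (la mu : seq nat)
    (la_part : is_partition_of l la) (mu_part : is_partition_of l mu)
    (L : tableau l la) (M : tableau l mu)
    (L_col : column_tableau L) (M_col : column_tableau M) :
  la <> mu -> ~ equivalent_modules (V R L) (V R M).
Proof.
move=> lamu equiv; apply: lamu.
apply: (contents_sum_heights (R := R) l_gt0 la_part mu_part).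
apply: left_ideal_scalar equiv.
- exact: jm_total_central.
- exact: jm_total_F_val.
- exact: jm_total_F_val.
exact: F_val_neq0.
Qed.
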